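(* There exists a bounded non-decreasing function $\Phi:[0,\infty)\to\mathbb{R}$ such that $$\frac{W(z)}{z}=\int_0^\infty\frac{d\Phi(u)}{1+uz}\qquad\text{for all } z\in\mathbb{C}\setminus\{0\} \text{ with } |\arg z|<\pi .$$
   Context: $W$ denotes the principal branch of the Lambert $W$ function: the unique holomorphic function on $\mathbb{C}\setminus(-\infty,-1/e]$ with $W(z)e^{W(z)}=z$ and $W(0)=0$ (it maps the positive real axis onto itself). The integral is a Lebesgue–Stieltjes integral. $|\arg z|<\pi$ means $z\in\mathbb{C}\setminus(-\infty,0]$. *)

(* Defs.v *)
From HB Require Import structures.
From mathcomp Require Import all_boot all_order all_algebra.
From mathcomp Require Import complex.
From mathcomp Require Import all_classical all_reals all_analysis.

Set Implicit Arguments.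
Unset Strict Implicit.
Unset Printing Implicit Defensive.
Import Order.TTheory GRing.Theory Num.Theory.
Import numFieldNormedType.Exports.

Local Open Scope classical_set_scope.
Local Open Scope ring_scope.
Local Open Scope complex_scope.

Section Complex.
Variable R : realType.
Implicit Types z : R[i].

Definition cexp z : R[i] :=
  (expR (complex.Re z) * cos (complex.Im z))
    +i* (expR (complex.Re z) * sin (complex.Im z)).

(* The plane cut along the real half-line (-oo, a]. *)
Definition slit_plane (a : R) : set R[i] :=
  [set z | ~ (complex.Im z = 0 /\ complex.Re z <= a)].

(* [derivable] is taken over the field R[i], so this is complex
   differentiability at every point of the open set D. *)
Definition holomorphic_on (D : set R[i]) (f : R[i] -> R[i]) : Prop :=
  forall z, D z -> derivable (f : R[i]^o -> R[i]^o) z 1.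

(* These conditions determine W on the cut plane; its values on the cut are
   left unconstrained. *)
Definition principal_lambertW (W : R[i] -> R[i]) : Prop :=
  let D := slit_plane (- (expR 1)^-1) in
  [/\ holomorphic_on D W,
      forall z, D z -> W z * cexp (W z) = z
    & W 0 = 0].

End Complex.

Section LebesgueStieltjes.
Variable R : realType.

(* Functions [0, +oo) -> R are represented by functions R -> R of which only
   the values on [0, +oo) matter. *)
Definition nondecreasing_nonneg (Phi : R -> R) : Prop :=
  forall x y, 0 <= x -> x <= y -> Phi x <= Phi y.

Section Measure.
Variables (Phi : R -> R) (ndPhi : nondecreasing_nonneg Phi).

(* The right limit at x of the extension of Phi by the constant Phi 0 to the
   negative reals. No right-continuity of Phi is assumed; the resulting measure
   gives ]a, b] the mass Phi(b+) - Phi(a+) for 0 <= a <= b, and gives {0} the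
   mass Phi(0+) - Phi(0). The proof argument is there to carry the [cumulative]
   structure. *)
Definition stieltjes_cumulative of nondecreasing_nonneg Phi : R -> R :=
  fun x => inf [set Phi (Num.max y 0) | y in `]x, +oo[].

Local Notation F := (stieltjes_cumulative ndPhi).

Lemma nondecreasing_nonneg_ext x y : x <= y -> Phi (Num.max x 0) <= Phi (Num.max y 0).
Proof.
move=> xy; apply: ndPhi; first by rewrite le_max lexx orbT.
by rewrite ge_max !le_max xy lexx /= orbT.
Qed.

Lemma stieltjes_cumulative_has_inf x : has_inf [set Phi (Num.max y 0) | y in `]x, +oo[].
Proof.
split; first by exists (Phi (Num.max (x + 1) 0)), (x + 1) => //=;
  rewrite in_itv/= andbT ltrDl.
exists (Phi (Num.max x 0)) => _ [y /= + <-]; rewrite in_itv/= andbT => xy.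
exact/nondecreasing_nonneg_ext/ltW.
Qed.

Lemma stieltjes_cumulative_le x y : x < y -> F x <= Phi (Num.max y 0).
Proof.
move=> xy; apply: (ge_inf (stieltjes_cumulative_has_inf x).2).
by exists y => //=; rewrite in_itv/= andbT.
Qed.

Lemma stieltjes_cumulative_nd : nondecreasing F.
Proof.
move=> x y xy; apply: lb_le_inf; first exact: (stieltjes_cumulative_has_inf y).1.
move=> _ [z /= + <-]; rewrite in_itv/= andbT => yz.
exact/stieltjes_cumulative_le/(le_lt_trans xy).
Qed.

Lemma stieltjes_cumulative_rc : right_continuous F.
Proof.
move=> x; apply/cvgrPdist_lt => e e0.
have [_ [y /= + <-] ye] := inf_adherent e0 (stieltjes_cumulative_has_inf x).
rewrite in_itv/= andbT => xy.
near=> t; rewrite ler0_norm ?subr_le0; last by apply: stieltjes_cumulative_nd; near: t;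
  exact: nbhs_right_ge.
rewrite opprB ltrBlDl; apply: le_lt_trans ye; apply: stieltjes_cumulative_le.
by near: t; exact: nbhs_right_lt.
Unshelve. all: by end_near. Qed.

HB.instance Definition _ := isCumulative.Build R _ R F
  stieltjes_cumulative_nd stieltjes_cumulative_rc.

Definition stieltjes_measure := lebesgue_stieltjes_measure F.
HB.instance Definition _ := SigmaFiniteMeasure.on stieltjes_measure.

(* [\int] is real-valued here: the integral is taken componentwise. *)
Definition stieltjes_integral (f : R -> R[i]) : R[i] :=
  (\int[stieltjes_measure]_(u in `[0, +oo[) complex.Re (f u))
    +i* (\int[stieltjes_measure]_(u in `[0, +oo[) complex.Im (f u)).

End Measure.
End LebesgueStieltjes.

(* Main.v *)
Require Import Defs.
From HB Require Import structures.
From mathcomp Require Import all_boot all_order all_algebra.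
From mathcomp Require Import complex ring lra zify.
From mathcomp Require Import all_classical all_reals all_analysis.
From mathcomp Require Import measurable_realfun.

Set Implicit Arguments.
Unset Strict Implicit.
Unset Printing Implicit Defensive.
Import Order.TTheory GRing.Theory Num.Theory.
Import numFieldNormedType.Exports.
Import ComplexField.Normc.

Local Open Scope classical_set_scope.
Local Open Scope ring_scope.
Local Open Scope complex_scope.

(** By Lagrange inversion W(z)/z = sum_n m_n (-z)^n near 0, with
    m_n = (n+1)^n/(n+1)!. Since 1/(1+uz) = sum_n u^n (-z)^n, a measure that
    represents W(z)/z must have the moments m_n and live on [0, e]. The proof
    builds a positive functional with these moments and then recovers W from
    it, by algebra and a differential equation. No contour integral and no
    boundary value of W is involved.

    Positivity. The sequence m_n/e^n is completely monotone
    ([monotone_upto_lambert_moment]). Up to the factor e/(n+1) it is the Stirling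
    ratio (k/e)^k/k! at k = n+1. Consecutive ratios have the quotient
    e (1 - 1/j)^(j-1) = exp(sum_(k >= 1) 1/(k(k+1) j^k)) with j = n+2, and the
    ratio at n is a limit of positive constants times products of these
    quotients from n on. Complete monotonicity of 1/j carries over to it, because
    it is stable under sums, products and limits. Hausdorff's argument with Bernstein
    polynomials and a limit along an ultrafilter then gives a positive linear
    functional L on the bounded functions on [0, e] with L(t^n) = m_n
    ([hausdorff_moment_functional]).

    The functional equation. Abel's identity yields the recurrence
    (n+1) m_(n+1) = (n+2)/2 sum_i m_i m_(n-i) ([lambert_moment_conv]), which is
    the equation z F' (1 + F) = F for F(z) = L(z/(1+tz)), coefficient by
    coefficient. The power series in z only converges near 0. At an arbitrary
    point of the slit plane, 1/(1+tz) is expanded instead in powers of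
    y(t) = 1 - alpha (1+tz), where alpha is chosen so that |y| <= q < 1 on
    [0, e] ([slit_plane_contraction]). The recurrence has a form that is free of
    the basis of polynomials ([moment_derivation]); read in the powers of y and
    summed, it gives the differential equation on the whole slit plane
    ([stieltjes_equation]).

    Identification. Along the ray s |-> s z the function P(s) = F(s z) satisfies
    s P' (1 + P) = P, so that P exp(P)/s is constant, and its limit at s = 0 is
    z ([ray_transform_lambert]). Hence P(s) and W(s z) are continuous, vanish at
    s = 0 and both solve w exp(w) = s z. Solutions are isolated from one another
    as long as w <> -1, that is s z <> -1/e, so the two paths coincide
    ([cexp_branch_unique], [principal_lambertW_ray]).

    The measure. Phi(x) is the value of L on the indicator of u < x. The
    Stieltjes integral against Phi agrees with L on step functions up to the
    mesh, hence on bounded Lipschitz functions ([stieltjes_integral_mfunct]), and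
    the real and imaginary parts of u |-> 1/(1+uz) are of this kind. *)

(** * Completely monotone sequences *)

Section CompletelyMonotone.
Variable R : realType.
Implicit Types (a b : nat -> R) (K n : nat).

(** Complete monotonicity truncated at order K: all iterated differences of
    order at most K are nonnegative. The truncation makes induction on K
    possible, since the difference sequence is one order less monotone. *)
Fixpoint monotone_upto K a : Prop :=
  (forall n, 0 <= a n) /\
  (if K is K'.+1 then monotone_upto K' (fun n => a n - a n.+1) else True).

Lemma monotone_upto_ge0 K a n : monotone_upto K a -> 0 <= a n.
Proof. by case: K => [|K] [/(_ n)]. Qed.

Lemma monotone_uptoW K a : monotone_upto K.+1 a -> monotone_upto K a.
Proof.
elim: K a => [|K IHK] a [a0 aS] //=; split => //.
exact: IHK.
Qed.

Lemma monotone_upto_shift K a :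
  monotone_upto K a -> monotone_upto K (fun n => a n.+1).
Proof.
elim: K a => [|K IHK] a [a0 aS] /=; split => //.
exact: (IHK (fun n => a n - a n.+1)).
Qed.

Lemma monotone_upto0 K : monotone_upto K (fun=> 0).
Proof.
elim: K => [|K IHK] /=; split => //.
by under eq_fun do rewrite subr0.
Qed.

Lemma monotone_upto_cst K (c : R) : 0 <= c -> monotone_upto K (fun=> c).
Proof.
move=> c0; case: K => [|K] /=; split => //.
by under eq_fun do rewrite subrr; exact: monotone_upto0.
Qed.

Lemma monotone_uptoD K a b : monotone_upto K a -> monotone_upto K b ->
  monotone_upto K (fun n => a n + b n).
Proof.
elim: K a b => [|K IHK] a b [a0 aS] [b0 bS] /=.
  by split => // n; rewrite addr_ge0.
split => [n|]; first by rewrite addr_ge0.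
by under eq_fun do rewrite opprD addrACA; exact: IHK.
Qed.

(** Leibniz rule: a_n b_n - a_(n+1) b_(n+1) =
    (a_n - a_(n+1)) b_n + a_(n+1) (b_n - b_(n+1)). *)
Lemma monotone_uptoM K a b : monotone_upto K a -> monotone_upto K b ->
  monotone_upto K (fun n => a n * b n).
Proof.
elim: K a b => [|K IHK] a b.
  by move=> [a0 _] [b0 _]; split => // n; rewrite mulr_ge0.
move=> Ka Kb; split => [n|].
  by rewrite mulr_ge0// (@monotone_upto_ge0 K.+1).
have -> : (fun n => a n * b n - a n.+1 * b n.+1) =
    (fun n => (a n - a n.+1) * b n + a n.+1 * (b n - b n.+1)).
  by apply/funext => n; ring.
apply: monotone_uptoD; apply: IHK.
- exact: Ka.2.
- exact: monotone_uptoW.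
- exact/monotone_upto_shift/monotone_uptoW.
- exact: Kb.2.
Qed.

Lemma monotone_uptoX K a i :
  monotone_upto K a -> monotone_upto K (fun n => a n ^+ i).
Proof.
move=> Ka; elim: i => [|i IHi].
  by under eq_fun do rewrite expr0; exact: monotone_upto_cst.
by under eq_fun do rewrite exprS; exact: monotone_uptoM.
Qed.

Lemma monotone_upto_sum K (f : nat -> nat -> R) N :
  (forall k, monotone_upto K (f k)) ->
  monotone_upto K (fun n => \sum_(k < N) f k n).
Proof.
move=> Kf; elim: N => [|N IHN].
  by under eq_fun do rewrite big_ord0; exact: monotone_upto0.
by under eq_fun do rewrite big_ord_recr/=; exact: monotone_uptoD.
Qed.

Lemma monotone_upto_prod K (f : nat -> nat -> R) N :
  (forall k, monotone_upto K (f k)) ->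
  monotone_upto K (fun n => \prod_(k < N) f k n).
Proof.
move=> Kf; elim: N => [|N IHN].
  by under eq_fun do rewrite big_ord0; exact: monotone_upto_cst.
by under eq_fun do rewrite big_ord_recr/=; exact: monotone_uptoM.
Qed.

Lemma monotone_upto_cvg K (f : nat -> nat -> R) a :
  (forall i, monotone_upto K (f i)) ->
  (forall n, f i n @[i --> \oo] --> a n) -> monotone_upto K a.
Proof.
elim: K f a => [|K IHK] f a Kf fa.
  split => // n; apply: (cvgr_to_ge (fa n)).
  by apply: nearW => i; exact: (monotone_upto_ge0 n (Kf i)).
split => [n|].
  apply: (cvgr_to_ge (fa n)).
  by apply: nearW => i; exact: (monotone_upto_ge0 n (Kf i)).
apply: (IHK (fun i n => f i n - f i n.+1)) => [i|n].
  exact: (Kf i).2.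
by apply: cvgB; exact: fa.
Qed.

(** The exponential series has nonnegative coefficients, so its partial sums
    at a_n are sums of products of monotone sequences. *)
Lemma monotone_upto_expR K a :
  monotone_upto K a -> monotone_upto K (fun n => expR (a n)).
Proof.
move=> Ka.
apply: (@monotone_upto_cvg K
  (fun N n => \sum_(k < N) a n ^+ k * (k`!%:R)^-1)) => [N|n].
  apply: (monotone_upto_sum (f := fun k n => a n ^+ k * (k`!%:R)^-1)) => k.
  apply: monotone_uptoM; first exact: monotone_uptoX.
  by apply: monotone_upto_cst; rewrite invr_ge0.
have /cvg_ex[l ul] := is_cvg_series_exp_coeff (a n).
rewrite /expR /= (cvg_lim _ ul)//.
apply: cvg_trans ul; apply: near_eq_cvg; apply: nearW => N /=.
by rewrite /series /= big_mkord.
Qed.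

(** The difference of 1/(n+c) is 1/(n+c) * 1/(n+c+1), a product of two
    sequences of the same family, one order lower. *)
Lemma monotone_upto_inv K (c : R) :
  0 < c -> monotone_upto K (fun n => (n%:R + c)^-1).
Proof.
elim: K c => [|K IHK] c c0.
  by split => // n; rewrite invr_ge0 addr_ge0// ltW.
split => [n|]; first by rewrite invr_ge0 addr_ge0// ltW.
have -> : (fun n => (n%:R + c)^-1 - (n.+1%:R + c)^-1) =
    (fun n => (n%:R + c)^-1 * (n%:R + (1 + c))^-1).
  apply/funext => n; have n0 : 0 <= n%:R :> R by [].
  rewrite -natr1; field.
  by apply/andP; split; lra.
by apply: monotone_uptoM; apply: IHK => //; lra.
Qed.

End CompletelyMonotone.

(** * Complete monotonicity of the moments *)

(** (-1)^n times the Taylor coefficient of z^n in W(z)/z, by Lagrange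
    inversion. The base field is kept free because the quadratic recurrence is
    used over R[i] and the positivity over R. *)
Definition lambert_moment (F : numFieldType) (n : nat) : F :=
  n.+1%:R ^+ n / n.+1`!%:R.
Arguments lambert_moment {F} n.

Section LambertMoments.
Variable R : realType.
Implicit Types (n K : nat) (x : R).

(** The derivative of the difference at t is t^K/(1-t), the remainder of the
    geometric series; the mean value theorem gives the bound. *)
Lemma ln1B_series_bound x K : 0 < x < 1 ->
  `|- ln (1 - x) - \sum_(k < K) x ^+ k.+1 / k.+1%:R| <= x ^+ K.+1 / (1 - x).
Proof.
move=> /andP[x0 x1].
pose g t : R := - ln (1 - t) - \sum_(k < K) t ^+ k.+1 / k.+1%:R.
have dg (t : R) : t < 1 -> is_derive t 1 g (t ^+ K / (1 - t)).
  move=> t1.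
  pose p : {poly R} := \sum_(k < K) k.+1%:R^-1 *: 'X^(k.+1).
  have dS : is_derive t (1 : R) (horner p) (\sum_(k < K) t ^+ k).
    have -> : \sum_(k < K) t ^+ k = p^`().[t]; last exact: is_derive_poly.
    rewrite /p raddf_sum horner_sum; apply: eq_bigr => k _.
    rewrite /= derivZ derivXn hornerZ hornerMn hornerXn -[X in _ * X]mulr_natl.
    by rewrite mulrA mulVf ?mul1r ?pnatr_eq0.
  have tt : 0 < 1 - t by lra.
  have dl : is_derive t 1 (fun t : R => ln (1 - t)) (- (1 - t)^-1).
    have h : is_derive (1 - t) 1 (@ln R) (1 - t)^-1 by exact: is_derive1_ln.
    have h' : is_derive t 1 (fun t : R => 1 - t) (- 1).
      by rewrite -[- 1]add0r; apply: is_deriveB.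
    rewrite -[- _^-1]mulrN1; exact: (@is_derive1_comp _ (@ln R) (fun t : R => 1 - t)).
  have -> : g = (- (fun t : R => ln (1 - t))) - horner p.
    apply/funext => u; rewrite /g /= fctE !fctE/= horner_sum; congr (_ - _).
    by apply: eq_bigr => k _; rewrite hornerZ hornerXn mulrC.
  apply: is_derive_eq.
  have := subrXX 1 t K; rewrite expr1n => H.
  have : \sum_(k < K) t ^+ k = (1 - t ^+ K) / (1 - t).
    rewrite H mulrAC divff ?gt_eqF// mul1r.
    by apply: eq_bigr => i _; rewrite expr1n mul1r.
  by move=> ->; field; lra.
have [c /[!in_itv]/= /andP[c0 cx] gxE] : exists2 c, c \in `]0, x[%R &
    g x - g 0 = c ^+ K / (1 - c) * (x - 0).
  apply: MVT => // [t|].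
    by rewrite in_itv/= => /andP[_ tx]; apply: dg; lra.
  apply: derivable_within_continuous => t; rewrite in_itv/= => /andP[_ tx].
  have ? : is_derive t 1 g (t ^+ K / (1 - t)) by apply: dg; lra.
  exact: ex_derive.
have g0 : g 0 = 0.
  rewrite /g subr0 ln1 oppr0 big1 ?subrr// => i _.
  by rewrite expr0n/= mul0r.
rewrite -[X in `|X|]/(g x); move: gxE; rewrite g0 !subr0 => ->.
rewrite ger0_norm; last first.
  by rewrite mulr_ge0// ?ltW// divr_gt0 ?exprn_gt0//; lra.
have cK : c ^+ K <= x ^+ K by rewrite lerXn2r ?nnegrE; lra.
have x1V : (1 - c)^-1 <= (1 - x)^-1 by rewrite lef_pV2 ?posrE; lra.
have cV0 : 0 <= (1 - c)^-1 by rewrite invr_ge0; lra.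
rewrite exprSr [leRHS]mulrAC; apply: ler_wpM2r; first exact: ltW.
by apply: ler_pM => //; apply: exprn_ge0; exact: ltW.
Qed.

(** The quotient of two consecutive Stirling ratios, see [stirling_ratioS]. *)
Definition lambert_ratio n : R := expR 1 * (n.+1%:R / n.+2%:R) ^+ n.+1.

Lemma lambert_ratioE n :
  lambert_ratio n = expR (1 + n.+1%:R * ln (1 - n.+2%:R^-1)).
Proof.
have n2 : 0 < n.+2%:R :> R by rewrite ltr0n.
have -> : 1 - n.+2%:R^-1 = n.+1%:R / n.+2%:R :> R.
  by move: n2; rewrite -[n.+2%:R]natr1 => n2; field; lra.
rewrite expRD mulr_natl -lnXn ?divr_gt0 ?ltr0n// lnK//.
by rewrite posrE exprn_gt0// divr_gt0// ltr0n.
Qed.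

(** With x = 1/(n+2), the exponent 1 + (1/x - 1) ln(1-x) is the power series
    sum_(k >= 1) x^k/(k(k+1)). Its coefficients are nonnegative and 1/(n+2) is
    completely monotone in n. *)
Lemma monotone_upto_lambert_ratio K : monotone_upto K lambert_ratio.
Proof.
rewrite (_ : lambert_ratio = fun n => expR (1 + n.+1%:R * ln (1 - n.+2%:R^-1))).
  2: by apply/funext => n; exact: lambert_ratioE.
apply: monotone_upto_expR.
pose T k n : R := (k.+1%:R * k.+2%:R)^-1 * (n%:R + 2)^-1 ^+ k.+1.
apply: (@monotone_upto_cvg _ K (fun N n => \sum_(k < N) T k n)) => [N|n].
  apply: monotone_upto_sum => k; apply: monotone_uptoM.
    by apply: monotone_upto_cst; rewrite invr_ge0 mulr_ge0.
  by apply: monotone_uptoX; exact: monotone_upto_inv.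
pose x : R := n.+2%:R^-1.
have x0 : 0 < x by rewrite invr_gt0 ltr0n.
have x1 : x < 1 by rewrite invf_lt1 ?ltr0n// ltr1n.
have xV : n.+1%:R = x^-1 - 1 by rewrite /x invrK -[n.+2%:R]natr1 addrK.
pose A N : R := \sum_(k < N) x ^+ k.+1 / k.+1%:R.
have Acvg : A N @[N --> \oo] --> - ln (1 - x).
  apply/cvgrPdist_le => e e0.
  have xN : (fun N => x ^+ N.+1 / (1 - x)) @ \oo --> 0.
    rewrite -[0](mul0r (1 - x)^-1); apply: cvgMl.
    rewrite (cvg_shiftS (fun N => x ^+ N)); apply: cvg_expr.
    by rewrite gtr0_norm.
  move/cvgrPdist_le : xN => /(_ e e0); apply: filterS => N.
  rewrite sub0r normrN => /(le_trans (ler_norm _)); apply: le_trans.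
  by apply: ln1B_series_bound; rewrite x0.
have -> : (fun N => \sum_(k < N) T k n) = (fun N => 1 + A N - x^-1 * A N.+1).
  apply/funext => N; rewrite /A big_ord_recl/= expr1 divr1 mulrDr mulVf ?gt_eqF//.
  rewrite opprD addrACA subrr add0r mulr_sumr -sumrB; apply: eq_bigr => k _.
  rewrite /T -natrD addn2 -/x /bump/= add1n.
  have k0 : 0 <= k%:R :> R by [].
  rewrite [x ^+ k.+2]exprS -[k.+2%:R]natr1; field.
  by apply/and3P; split; lra.
rewrite xV (_ : 1 + _ = 1 + (- ln (1 - x)) - x^-1 * (- ln (1 - x))); last by ring.
apply: cvgB; first by apply: cvgD => //; exact: cvg_cst.
by apply: cvgMr; rewrite (cvg_shiftS A).
Qed.

Lemma lambert_ratio_cvg1 : lambert_ratio n @[n --> \oo] --> (1 : R).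
Proof.
have H : (n.+1%:R^-1 : R) @[n --> \oo] --> (0 : R) by exact: cvg_harmonic.
apply: (@squeeze_cvgr _ _ _ _ (fun=> 1) (fun n => expR n.+1%:R^-1)).
- apply: nearW => n; rewrite lambert_ratioE.
  have n1 : 0 < n.+1%:R :> R by rewrite ltr0n.
  have n2 : 0 < n.+2%:R :> R by rewrite ltr0n.
  have n2E : n.+2%:R = n.+1%:R + 1 :> R by rewrite natr1.
  set l := ln _.
  have lle : l <= - n.+2%:R^-1.
    apply: le_ln1Dx; rewrite ltrN2 invf_lt1// ltr1n//.
  have lge : - n.+1%:R^-1 <= l.
    rewrite /l (_ : 1 - _ = (1 + n.+1%:R^-1)^-1); last first.
      by rewrite n2E; field; lra.
    rewrite lnV ?posrE ?addr_gt0 ?invr_gt0// lerN2; apply: le_ln1Dx.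
    by apply: lt_trans (_ : 0 < _); rewrite ?invr_gt0// oppr_lt0.
  apply/andP; split.
    rewrite (_ : 1 + _ = n.+1%:R * (l + n.+1%:R^-1)); last by field; lra.
    rewrite -[leLHS]expR0 ler_expR; apply: mulr_ge0; first exact: ltW.
    by rewrite -lerBlDr sub0r.
  rewrite ler_expR -lerBrDl (_ : n.+1%:R^-1 - 1 = n.+1%:R * (- n.+2%:R^-1) + (n.+1%:R ^-1 - n.+2%:R^-1)); last first.
    by rewrite n2E; field; lra.
  apply: ler_wpDr; last by rewrite ler_pM2l.
  by rewrite subr_ge0 lef_pV2 ?posrE// ler_nat.
- exact: cvg_cst.
- by have := cvg_comp _ _ H (@continuous_expR R 0); rewrite expR0.
Qed.

(** (k/e)^k / k! at k = n+1, which is lambert_moment n / e^n up to the factor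
    e/(n+1). *)
Definition stirling_ratio n : R := n.+1%:R ^+ n.+1 / n.+1`!%:R / expR 1 ^+ n.+1.

Lemma stirling_ratioS n :
  stirling_ratio n = stirling_ratio n.+1 * lambert_ratio n.
Proof.
rewrite /stirling_ratio /lambert_ratio [n.+2`!]factS natrM.
have f0 : n.+1`!%:R != 0 :> R by rewrite pnatr_eq0 -lt0n fact_gt0.
have e0 : expR 1 != 0 :> R by rewrite expR_eq0.
have n2 : n.+2%:R != 0 :> R by rewrite pnatr_eq0.
rewrite expr_div_n [n.+2%:R ^+ n.+2]exprS [expR 1 ^+ n.+2]exprS.
move: (n.+1`!%:R : R) (expR 1 : R) (n.+2%:R : R) f0 e0 n2 => F E M f0 e0 n2.
by field; rewrite f0 e0 n2 !expf_neq0.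
Qed.

Lemma stirling_ratio_gt0 n : 0 < stirling_ratio n.
Proof.
by rewrite /stirling_ratio !divr_gt0 ?exprn_gt0 ?expR_gt0 ?ltr0n ?fact_gt0.
Qed.

Lemma stirling_ratio_prod n N : stirling_ratio n =
  stirling_ratio (n + N) * \prod_(k < N) lambert_ratio (n + k).
Proof.
elim: N => [|N IHN]; first by rewrite addn0 big_ord0 mulr1.
rewrite big_ord_recr/= IHN stirling_ratioS addnS; ring.
Qed.

(** The ratio at n is the limit over N of the product of the ratio at N, a
    constant in n, with lambert_ratio (n + k) for k < N: both sides count the
    same consecutive quotients, and the n quotients left over tend to 1. *)
Lemma monotone_upto_stirling_ratio K : monotone_upto K stirling_ratio.
Proof.
apply: (@monotone_upto_cvg _ K
    (fun N n => stirling_ratio N * \prod_(k < N) lambert_ratio (n + k))) => [N|n].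
  apply: monotone_uptoM.
    by apply: monotone_upto_cst; exact/ltW/stirling_ratio_gt0.
  apply: (monotone_upto_prod (f := fun k n => lambert_ratio (n + k))) => k.
  elim: k => [|k IHk].
    by under eq_fun do rewrite addn0; exact: monotone_upto_lambert_ratio.
  under eq_fun do rewrite addnS -addSn.
  exact: (monotone_upto_shift IHk).
have -> : (fun N => stirling_ratio N * \prod_(k < N) lambert_ratio (n + k)) =
    (fun N => stirling_ratio n * \prod_(k < n) lambert_ratio (k + N)).
  apply/funext => N.
  have h0 := stirling_ratio_gt0 (n + N).
  rewrite (stirling_ratio_prod n N) (stirling_ratio_prod N n) (addnC N n).
  rewrite mulrAC; congr (_ * _ * _).
  by apply: eq_bigr => i _; rewrite addnC.
rewrite -[X in _ --> X]mulr1; apply: cvgMr.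
elim: {K} n => [|m IHm].
  by under eq_fun do rewrite big_ord0; exact: cvg_cst.
have lcvg : lambert_ratio (m + N) @[N --> \oo] --> (1 : R).
  rewrite (_ : (fun N => _) = (fun N => lambert_ratio (N + m))).
    by rewrite cvg_shiftn; exact: lambert_ratio_cvg1.
  by apply/funext => N; rewrite addnC.
have H := cvgM IHm lcvg; rewrite mulr1 in H.
apply: (cvg_trans _ (H _)); apply: near_eq_cvg.
by apply: nearW => N /=; rewrite big_ord_recr.
Qed.

Lemma monotone_upto_lambert_moment K :
  monotone_upto K (fun n => lambert_moment n / expR 1 ^+ n : R).
Proof.
have -> : (fun n => lambert_moment n / expR 1 ^+ n : R) =
    (fun n => expR 1 * ((n%:R + 1)^-1 * stirling_ratio n)).
  apply/funext => n; rewrite /lambert_moment /stirling_ratio !exprS natr1.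
  have n1 : 1 + n%:R != 0 :> R by rewrite nat1r.
  field; rewrite n1 pnatr_eq0 -lt0n fact_gt0 expR_eq0 expf_neq0//.
apply: monotone_uptoM; first exact/monotone_upto_cst/expR_ge0.
apply: monotone_uptoM; first exact: monotone_upto_inv.
exact: monotone_upto_stirling_ratio.
Qed.

End LambertMoments.

(** * Polynomials paired with a sequence *)

Section PolynomialExtension.
Variables (F : comNzRingType) (V : lmodType F).
Implicit Types (b : nat -> V) (p q : {poly F}).

(** The linear map on polynomials that takes X^n to b n. *)
Definition poly_extend b p : V := \sum_(i < size p) p`_i *: b i.

Lemma poly_extend_widen b p N : (size p <= N)%N ->
  poly_extend b p = \sum_(i < N) p`_i *: b i.
Proof.
move=> pN; rewrite /poly_extend (big_ord_widen _ (fun i => p`_i *: b i) pN).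
rewrite big_mkcond/=; apply: eq_bigr => i _; case: ltnP => // pi.
by rewrite nth_default ?scale0r.
Qed.

Lemma poly_extend_is_linear b : linear (poly_extend b).
Proof.
move=> c p q; pose N := maxn (size p) (size q).
have sN : (size (c *: p + q)%R <= N)%N.
  rewrite (leq_trans (size_polyD _ _))// geq_max leq_maxr andbT.
  by rewrite (leq_trans (size_scale_leq _ _))// leq_maxl.
rewrite (poly_extend_widen b sN) (poly_extend_widen b (leq_maxl _ _ : size p <= N)%N).
rewrite (poly_extend_widen b (leq_maxr _ _ : size q <= N)%N).
rewrite scaler_sumr -big_split/=; apply: eq_bigr => i _.
by rewrite coefD coefZ scalerDl scalerA.
Qed.

HB.instance Definition _ b := GRing.isLinear.Build F {poly F} V _ _
  (poly_extend_is_linear b).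

Lemma poly_extendXn b n : poly_extend b 'X^n = b n.
Proof.
rewrite (@poly_extend_widen b _ n.+1) ?size_polyXn// big_ord_recr/=.
rewrite big1 => [|i _]; rewrite coefXn ?eqxx ?scale1r ?add0r//.
by rewrite ltn_eqF// scale0r.
Qed.

Lemma poly_extend_mulX b p :
  poly_extend b ('X * p) = poly_extend (fun n => b n.+1) p.
Proof.
rewrite mulrC (@poly_extend_widen b _ (size p).+1); last first.
  by rewrite (leq_trans (size_polyMleq _ _))// size_polyX addn2.
rewrite big_ord_recl coefMX eqxx scale0r add0r.
by apply: eq_bigr => i _; rewrite coefMX.
Qed.

Lemma poly_extendD b b' p :
  poly_extend (fun n => b n + b' n) p = poly_extend b p + poly_extend b' p.
Proof. by rewrite -big_split; apply: eq_bigr => i _; rewrite scalerDr. Qed.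

Lemma poly_extendB b b' p :
  poly_extend (fun n => b n - b' n) p = poly_extend b p - poly_extend b' p.
Proof. by rewrite -sumrB; apply: eq_bigr => i _; rewrite scalerBr. Qed.

End PolynomialExtension.

Section MomentPoly.
Variable F : comNzRingType.
Implicit Types (b : nat -> F) (p : {poly F}).

Definition moment_poly b p : F := poly_extend (b : nat -> F^o) p.

HB.instance Definition _ b := GRing.isLinear.Build F {poly F} F^o _
  (moment_poly b) (poly_extend_is_linear (b : nat -> F^o)).

Lemma moment_polyXn b n : moment_poly b 'X^n = b n.
Proof. exact: (@poly_extendXn F F^o). Qed.

Lemma moment_poly_mulX b p :
  moment_poly b ('X * p) = moment_poly (fun n => b n.+1) p.
Proof. exact: (@poly_extend_mulX F F^o). Qed.

Lemma moment_polyB b b' p :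
  moment_poly (fun n => b n - b' n) p = moment_poly b p - moment_poly b' p.
Proof. exact: (@poly_extendB F F^o). Qed.

End MomentPoly.

(** * The Hausdorff moment problem *)

Section Hausdorff.
Variable R : realType.
Implicit Types (b m : nat -> R) (f g : R -> R).

(** Pairing with X^k (1-X)^i gives the i-th iterated difference of b at k, so
    complete monotonicity is positivity on the Bernstein basis. *)
Lemma moment_poly_bernstein_ge0 b k i : monotone_upto i b ->
  0 <= moment_poly b ('X^k * (1 - 'X) ^+ i).
Proof.
elim: k b => [|k IHk] b bi; last first.
  by rewrite exprS -mulrA moment_poly_mulX; exact/IHk/monotone_upto_shift.
rewrite expr0 mul1r; elim: i b bi => [|i IHi] b bi.
  by rewrite expr0 -(expr0 'X) moment_polyXn; exact: (monotone_upto_ge0 0 bi).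
rewrite exprS mulrBl mul1r raddfB/= moment_poly_mulX -moment_polyB.
exact/IHi/bi.2.
Qed.

(** The value on the k-th Bernstein polynomial of degree N of the functional
    with moments b: the mass that a discretised measure puts at k/N. *)
Definition bernstein_weight b N k : R :=
  'C(N, k)%:R * moment_poly b ('X^k * (1 - 'X) ^+ (N - k)).

Definition bernstein_functional b N f : R :=
  \sum_(k < N.+1) bernstein_weight b N k * f (k%:R / N%:R).

Lemma bernstein_weight_ge0 b N k : (forall K, monotone_upto K b) ->
  0 <= bernstein_weight b N k.
Proof.
by move=> bmon; rewrite mulr_ge0//; exact: moment_poly_bernstein_ge0.
Qed.

Lemma bernstein_weight_sum b N :
  \sum_(k < N.+1) bernstein_weight b N k = b 0%N.
Proof.
have <- : moment_poly b (((1 - 'X) + 'X) ^+ N) = b 0%N.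
  by rewrite subrK expr1n -(expr0 'X) moment_polyXn.
rewrite exprDn raddf_sum/=; apply: eq_bigr => k _.
by rewrite /bernstein_weight mulr_natl mulrC raddfMn.
Qed.

Lemma bernstein_functional_bound b N f M : (forall K, monotone_upto K b) ->
  (forall t, 0 <= t <= 1 -> `|f t| <= M) ->
  `|bernstein_functional b N f| <= M * b 0%N.
Proof.
move=> bmon fM; rewrite -(bernstein_weight_sum b N) mulr_sumr.
apply: le_trans (ler_norm_sum _ _ _) _; apply: ler_sum => k _.
have w0 := bernstein_weight_ge0 N k bmon.
rewrite normrM (ger0_norm w0) mulrC ler_wpM2r// fM//.
rewrite divr_ge0//=; case: N k {w0} => [|N] k; first by rewrite invr0 mulr0.
by rewrite ler_pdivrMr ?ltr0n// mul1r ler_nat -ltnS.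
Qed.

Lemma normrB_expn (x y : R) j : 0 <= x <= 1 -> 0 <= y <= 1 ->
  `|x ^+ j - y ^+ j| <= j%:R * `|x - y|.
Proof.
move=> /andP[x0 x1] /andP[y0 y1]; rewrite subrXX normrM mulrC ler_wpM2r//.
apply: le_trans (ler_norm_sum _ _ _) _.
apply: (@le_trans _ _ (\sum_(i < j) 1)); last by rewrite sumr_const card_ord.
apply: ler_sum => i _; rewrite ger0_norm ?mulr_ge0 ?exprn_ge0//.
by rewrite mulr_ile1 ?exprn_ge0 ?exprn_ile1.
Qed.

(** Dropping the factor t turns the grid k/(M+1) into the grid k/M; the two
    are uniformly close. *)
Lemma grid_shift (k M : nat) : (k <= M)%N ->
  `|k.+1%:R / M.+1%:R - k%:R / M%:R| <= M.+1%:R^-1 :> R.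
Proof.
case: M => [|M] kM.
  by move: kM; rewrite leqn0 => /eqP ->; rewrite invr0 mulr0 subr0 mul1r ger0_norm.
have {kM} : k%:R <= M.+1%:R :> R by rewrite ler_nat.
have : 0 < M.+1%:R :> R by rewrite ltr0n.
rewrite -[M.+2%:R]natr1 -[k.+1%:R]natr1; have : 0 <= k%:R :> R by [].
move: (M.+1%:R : R) (k%:R : R) => x y y0 x0 yx.
rewrite (_ : _ - _ = (x - y) / x / (x + 1)); last by field; apply/andP; split; lra.
have xV : 0 <= (x + 1)^-1 by rewrite invr_ge0; lra.
have d0 : 0 <= (x - y) / x by apply: divr_ge0; lra.
rewrite ger0_norm; last exact: mulr_ge0.
by apply: ler_piMl => //; rewrite ler_pdivrMr//; lra.
Qed.

(** The absorption rule for binomials turns the weight at k+1 times its node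
    (k+1)/(M+1) into the weight at k for the shifted sequence. The two sides
    then differ only by the grid. *)
Lemma bernstein_functional_shift b M j : (forall K, monotone_upto K b) ->
  `|bernstein_functional b M.+1 (fun t => t ^+ j.+1)
    - bernstein_functional (fun n => b n.+1) M (fun t => t ^+ j)|
  <= (j%:R * b 1%N) * M.+1%:R^-1.
Proof.
move=> bmon.
have Sbmon K : monotone_upto K (fun n => b n.+1) by exact: monotone_upto_shift.
have M0 : M.+1%:R != 0 :> R by rewrite pnatr_eq0.
have -> : bernstein_functional b M.+1 (fun t => t ^+ j.+1) =
    \sum_(k < M.+1) bernstein_weight (fun n => b n.+1) M k * (k.+1%:R / M.+1%:R) ^+ j.
  rewrite /bernstein_functional big_ord_recl/= mul0r expr0n/= mulr0 add0r.
  apply: eq_bigr => k _; rewrite /bump/= add1n exprS mulrA; congr (_ * _).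
  rewrite /bernstein_weight subSS exprS -mulrA moment_poly_mulX mulrAC; congr (_ * _).
  by rewrite mulrA -natrM mulnC -(mul_bin_diag M.+1 k) natrM mulrC mulrA mulVf// mul1r.
have -> : j%:R * b 1%N * M.+1%:R^-1 = \sum_(k < M.+1)
    bernstein_weight (fun n => b n.+1) M k * (j%:R * M.+1%:R^-1).
  by rewrite -mulr_suml bernstein_weight_sum mulrCA mulrA.
rewrite /bernstein_functional -sumrB; apply: le_trans (ler_norm_sum _ _ _) _.
apply: ler_sum => k _; rewrite -mulrBr normrM ger0_norm ?bernstein_weight_ge0//.
apply: ler_wpM2l; first exact: bernstein_weight_ge0.
have M1 : 0 < M.+1%:R :> R by rewrite ltr0n.
have kM : k%:R <= M%:R :> R by rewrite ler_nat -ltnS.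
have k0 : 0 <= k%:R :> R by [].
apply: le_trans (normrB_expn j _ _) _.
- by rewrite divr_ge0//= ler_pdivrMr// mul1r ler_nat.
- rewrite divr_ge0//=; case: M k kM {Sbmon M0 M1 k0} => [|M] k kM; first by rewrite invr0 mulr0.
  by rewrite ler_pdivrMr ?ltr0n// mul1r.
apply: ler_wpM2l => //.
by apply: grid_shift; rewrite -ltnS.
Qed.

Lemma bernstein_functional_moment b j : (forall K, monotone_upto K b) ->
  bernstein_functional b N (fun t => t ^+ j) @[N --> \oo] --> b j.
Proof.
elim: j b => [|j IHj] b bmon.
  rewrite (_ : (fun N => _) = (fun=> b 0%N)); first exact: cvg_cst.
  apply/funext => N; rewrite -(bernstein_weight_sum b N).
  by apply: eq_bigr => k _; rewrite expr0 mulr1.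
have Sbmon K : monotone_upto K (fun n => b n.+1) by exact: monotone_upto_shift.
rewrite -(cvg_shiftS (fun N => bernstein_functional b N (fun t => t ^+ j.+1))).
pose v N := bernstein_functional (fun n => b n.+1) N (fun t => t ^+ j).
pose u N := bernstein_functional b N.+1 (fun t => t ^+ j.+1).
have d0 : (u N - v N) @[N --> \oo] --> (0 : R).
  apply/norm_cvg0P.
  apply: (@squeeze_cvgr _ _ _ _ (fun=> 0)
    (fun N => (j%:R * b 1%N) * N.+1%:R^-1)); first 1 last.
  - exact: cvg_cst.
  - by rewrite -[X in _ --> X](mulr0 (j%:R * b 1%N)); apply: cvgMr; exact: cvg_harmonic.
  by apply: nearW => N; rewrite normr_ge0/=; exact: bernstein_functional_shift.
have := cvgD d0 (IHj _ Sbmon); rewrite add0r => H.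
apply: (cvg_trans _ (H _)); apply: near_eq_cvg; apply: nearW => N /=.
by rewrite /v subrK.
Qed.

(** A bounded sequence stays in a compact interval, where every ultrafilter
    converges. *)
Lemma ultra_bounded_cvg (U : set_system nat) (u : nat -> R) (M : R) :
  UltraFilter U -> (forall n, `|u n| <= M) -> cvg (u @ U).
Proof.
move=> UU uM.
have UP := @ultra_proper _ U UU.
have ultraUu : UltraFilter (u @ U).
  split; first exact: fmap_proper_filter.
  move=> G GP UuG; rewrite predeqE => A; split; last exact: UuG.
  move=> GA; have [//|nA] := in_ultra_setVsetC (u @^-1` A) UU.
  have GnA : G (~` A) by apply: UuG.
  by have [x []] := filter_ex (filterI GA GnA).
have := @segment_compact R (- M) M; rewrite compact_ultra => /(_ _ ultraUu).
case=> [|l [_ ul]]; last by apply/cvg_ex; exists l.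
by apply: (@filterS _ U _ setT) filterT => n _ /=; rewrite in_itv/= -ler_norml.
Qed.

Definition bounded_upto (B : R) f : Prop :=
  exists M : R, forall t : R, 0 <= t <= B -> `|f t| <= M.

(** L plays the part of integration against a measure on [0, B] with moments
    m. It is linear on all bounded functions, and not only on continuous ones,
    so that it can measure half-lines; nothing is said about countable
    additivity. *)
Record moment_functional (B : R) m (L : (R -> R) -> R) : Prop := {
  mfunct_linear : forall c f g, bounded_upto B f -> bounded_upto B g ->
    L (fun t => c * f t + g t) = c * L f + L g ;
  mfunct_ge0 : forall f, bounded_upto B f ->
    (forall t : R, 0 <= t <= B -> 0 <= f t) -> 0 <= L f ;
  mfunct_moment : forall n, L (fun t => t ^+ n) = m n }.

(** The limit of the Bernstein functionals along an ultrafilter exists for every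
    bounded function, is linear and positive, and on powers agrees with the
    ordinary limit. This replaces a weak compactness argument for measures. *)
Theorem hausdorff_moment_functional (B : R) m : 0 < B ->
  (forall K, monotone_upto K (fun n => m n / B ^+ n)) ->
  exists L, moment_functional B m L.
Proof.
move=> B0 mmon; set b := fun n => m n / B ^+ n in mmon.
(* Rescaling by B reduces to [0, 1]; one ultrafilter finer than eventually
   serves all functions, which makes the limit linear. *)
have [U [UU oU]] := ultraFilterLemma eventually_filter.
have UP := @ultra_proper _ U UU.
pose sc f : R -> R := fun t => f (B * t).
pose L f : R := lim (bernstein_functional b N (sc f) @[N --> U]).
have scB f : bounded_upto B f ->
    exists M : R, forall t : R, 0 <= t <= 1 -> `|sc f t| <= M.
  move=> [M fM]; exists M => t /andP[t0 t1]; apply: fM.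
  have B0' := ltW B0.
  by apply/andP; split; [exact: mulr_ge0|exact: ler_piMr].
have Lcvg f : bounded_upto B f ->
    bernstein_functional b N (sc f) @[N --> U] --> L f.
  move=> /scB[M fM]; apply: (@ultra_bounded_cvg _ _ (M * b 0%N)) => // N.
  exact: bernstein_functional_bound.
exists L; split.
- move=> c f g bf bg; apply: cvg_lim => //.
  have H : c * bernstein_functional b N (sc f) + bernstein_functional b N (sc g)
      @[N --> U] --> c * L f + L g.
    by apply: cvgD; [apply: cvgMr|]; exact: Lcvg.
  apply: (cvg_trans _ H); apply: near_eq_cvg.
  apply: (@filterS _ U _ setT) filterT => N _ /=.
  rewrite /bernstein_functional mulr_sumr -big_split/=; apply: eq_bigr => k _.
  by rewrite /sc mulrDr; congr (_ + _); rewrite mulrCA.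
- move=> f bf f0; apply: (cvgr_to_ge (Lcvg f bf)).
  apply: (@filterS _ U _ setT) filterT => N _; apply: sumr_ge0 => k _.
  apply: mulr_ge0; first exact: bernstein_weight_ge0.
  have B0' := ltW B0.
  apply: f0; apply/andP; split; first by rewrite mulr_ge0// divr_ge0.
  apply: ler_piMr => //.
  case: N k => [|N] k; first by rewrite invr0 mulr0.
  by rewrite ler_pdivrMr ?ltr0n// mul1r ler_nat -ltnS.
- move=> n.
  have bB : B ^+ n * b n = m n.
    by rewrite /b mulrC divfK// expf_neq0// gt_eqF.
  apply: cvg_lim => //; rewrite -bB.
  have H : bernstein_functional b N (fun t => t ^+ n) @[N --> U] --> b n.
    by move=> A /(bernstein_functional_moment mmon); exact: oU.
  have H1 : B ^+ n * bernstein_functional b N (fun t => t ^+ n)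
      @[N --> U] --> B ^+ n * b n by exact: cvgMr.
  apply: (cvg_trans _ H1); apply: near_eq_cvg.
  apply: (@filterS _ U _ setT) filterT => N _ /=.
  rewrite /bernstein_functional mulr_sumr; apply: eq_bigr => k _.
  by rewrite mulrCA -exprMn.
Qed.

End Hausdorff.

(** * Abel's identity and the convolution of the moments *)

Section AbelIdentity.
Variable F : numFieldType.
Implicit Types (n : nat) (x y : F).

(** Abel polynomials X (X + n)^(n-1), with value 1 at n = 0. *)
Definition abel_poly n : {poly F} :=
  if n is k.+1 then 'X * ('X + n%:R%:P) ^+ k else 1.

Lemma deriv_abel_poly n :
  (abel_poly n.+1)^`() = n.+1%:R *: (abel_poly n \Po ('X + 1%:P)).
Proof.
case: n => [|n]; first by rewrite /= expr0 mulr1 derivX comp_polyC scale1r.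
rewrite /abel_poly derivM derivX mul1r deriv_exp derivD derivX derivC addr0 mul1r.
rewrite /= comp_polyM rmorphXn/= comp_polyD comp_polyX comp_polyC.
have -> : 'X + 1%:P + n.+1%:R%:P = 'X + n.+2%:R%:P :> {poly F}.
  by rewrite -addrA -polyCD nat1r.
rewrite exprS -mul_polyC -[_ ^+ n *+ _]mulr_natr !polyC_natr.
ring.
Qed.

Lemma abel_poly0 n : (abel_poly n.+1).[0] = 0.
Proof. by rewrite /= hornerM hornerX mul0r. Qed.

Lemma poly_deriv0 (p : {poly F}) : p^`() = 0 -> p.[0] = 0 -> p = 0.
Proof.
move=> dp p0; apply/polyP => -[|i]; first by rewrite coef0 -horner_coef0.
have : (p^`())`_i = 0 by rewrite dp coef0.
by rewrite coef_deriv coef0 => /eqP; rewrite mulrn_eq0 /= => /eqP.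
Qed.

(** Abel's generalisation of the binomial theorem, by induction on n: since
    A_n'(x) = n A_(n-1)(x+1), the two sides have the same derivative, and they
    agree at 0. *)
Theorem abel_identity n y :
  \sum_(i < n.+1) ('C(n, i)%:R * (abel_poly (n - i)).[y]) *: abel_poly i
  = abel_poly n \Po ('X + y%:P).
Proof.
elim: n y => [|n IHn] y.
  by rewrite big_ord1 bin0 mul1r subnn /= hornerC scale1r comp_polyC.
apply/eqP; rewrite -subr_eq0; apply/eqP; apply: poly_deriv0; last first.
  rewrite hornerD hornerN horner_sum big_ord_recl big1 => [|i _]; last first.
    by rewrite hornerZ abel_poly0 mulr0.
  rewrite hornerZ bin0 mul1r subn0 /= hornerC mulr1 addr0.
  by rewrite horner_comp hornerD hornerX hornerC add0r subrr.
rewrite derivB deriv_comp derivD derivX derivC addr0 mulr1 deriv_abel_poly.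
rewrite linear_sum big_ord_recl /= derivZ derivC scaler0 add0r.
rewrite comp_polyZ -comp_polyA comp_polyD comp_polyX comp_polyC.
rewrite (_ : 'X + y%:P + 1%:P = ('X + y%:P) \Po ('X + 1%:P)); last first.
  by rewrite comp_polyD comp_polyX comp_polyC addrAC.
rewrite comp_polyA -IHn linear_sum scaler_sumr -sumrB; apply: big1 => i _.
rewrite /bump add1n derivZ deriv_abel_poly subSS /= comp_polyZ !scalerA.
rewrite mulrAC -natrM [(_ * i.+1)%N]mulnC -(mul_bin_diag n.+1 i) natrM mulrA subrr//.
Qed.

Lemma lambert_momentE n : lambert_moment n = (abel_poly n).[1] / n`!%:R :> F.
Proof.
rewrite /lambert_moment; case: n => [|n].
  by rewrite expr0 !divr1 /= hornerC.
rewrite /= hornerM hornerX horner_exp hornerD hornerX hornerC mul1r nat1r.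
rewrite [n.+2`!]factS natrM exprS invfM mulrACA mulfV ?mul1r// pnatr_eq0//.
Qed.

(** Abel's identity at x = y = 1 evaluates the convolution, because
    m_n = A_n(1)/n! while A_n(2)/n! is a multiple of m_(n+1). *)
Theorem lambert_moment_conv n :
  n.+1%:R * lambert_moment n.+1 =
  2^-1 * (n.+2%:R * \sum_(i < n.+1) lambert_moment (n - i) * lambert_moment i) :> F.
Proof.
have fn : n`!%:R != 0 :> F by rewrite pnatr_eq0 -lt0n fact_gt0.
have -> : \sum_(i < n.+1) lambert_moment (n - i) * lambert_moment i =
    (abel_poly n).[2] / n`!%:R.
  have := congr1 (fun p => p.[1]) (abel_identity n 1).
  rewrite horner_comp hornerD hornerX hornerC -[1 + 1]/2%:R => <-.
  rewrite horner_sum mulr_suml; apply: eq_bigr => i _.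
  rewrite !lambert_momentE hornerZ.
  have fi : i`!%:R != 0 :> F by rewrite pnatr_eq0 -lt0n fact_gt0.
  have fni : (n - i)`!%:R != 0 :> F by rewrite pnatr_eq0 -lt0n fact_gt0.
  have := congr1 (fun k => k%:R : F) (bin_fact (ltn_ord i : i <= n)%N).
  rewrite !natrM => bE.
  have /andP[c0 _] : ('C(n, i)%:R != 0 :> F) && (i`!%:R * (n - i)`!%:R != 0 :> F).
    by rewrite -negb_or -mulf_eq0 bE.
  rewrite -bE; move: ('C(n, i)%:R : F) (i`!%:R : F) ((n - i)`!%:R : F) c0 fi fni => u v w u0 v0 w0.
  by field; rewrite u0 v0 w0.
rewrite /lambert_moment; case: n fn => [|n] fn.
  by rewrite /= hornerC expr1 !mul1r invr1 !mulr1 mulrC.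
rewrite [n.+3`!]factS natrM [n.+2`!]factS natrM; move: (n.+1`!%:R : F) fn => u u0.
rewrite /= hornerM hornerX horner_exp hornerD hornerX hornerC -natrD.
rewrite [_ ^+ n.+2]exprS [_ ^+ n.+1]exprS !addSn add0n.
have n2 : n.+2%:R != 0 :> F by rewrite pnatr_eq0.
have n3 : n.+3%:R != 0 :> F by rewrite pnatr_eq0.
move: (n.+2%:R : F) (n.+3%:R : F) n2 n3 => v w v0 w0.
by field; rewrite u0 v0 w0.
Qed.

End AbelIdentity.

(** * The quadratic recurrence in an affine variable *)

Section MomentRecurrence.
Variable F : numFieldType.
Local Notation m := (@lambert_moment F).
Local Notation ell := (moment_poly m).
Implicit Types (p : {poly F}) (n : nat).

(** The moment functional in t applied to the divided difference
    (X^n - t^n)/(X - t). Its linear extension Delta sends p to the functional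
    applied to (p(X) - p(t))/(X - t). *)
Definition quotient_mono n : {poly F} := \sum_(i < n) m (n.-1 - i) *: 'X^i.

Local Notation Delta := (poly_extend quotient_mono).

Lemma quotient_monoS n :
  quotient_mono n.+1 = 'X * quotient_mono n + (m n)%:P.
Proof.
rewrite /quotient_mono big_ord_recl subn0 expr0 alg_polyC addrC; congr (_ + _).
rewrite mulr_sumr; apply: eq_bigr => i _.
rewrite -scalerAr -exprS /bump /=; congr (m _ *: _).
by case: n i => [|n] [i ilt]//=; rewrite /bump add1n subSS.
Qed.

(** The product rule for divided differences. *)
Lemma Delta_mulX p : Delta ('X * p) = 'X * Delta p + (ell p)%:P.
Proof.
rewrite poly_extend_mulX.
rewrite (_ : (fun n => _) = (fun n => 'X * quotient_mono n + (m n)%:P)).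
  rewrite poly_extendD; congr (_ + _).
    by rewrite mulr_sumr; apply: eq_bigr => i _; rewrite -scalerAr.
  rewrite /moment_poly /poly_extend rmorph_sum/=.
  by apply: eq_bigr => i _; rewrite -mul_polyC -polyCM.
by apply/funext => n; exact: quotient_monoS.
Qed.

Lemma linear_poly0 (f : {poly F} -> F) :
  (forall c p q, f (c *: p + q) = c * f p + f q) ->
  (forall n, f 'X^n = 0) -> forall p, f p = 0.
Proof.
move=> flin fX p; rewrite -(coefK p) poly_def.
have f0 : f 0 = 0 by have := flin (- 1) 1 1; rewrite scaleN1r addNr mulN1r addNr.
elim/big_rec: _ => [//|i q _ fq]; by rewrite flin fX fq mulr0 addr0.
Qed.

(** The recurrence [lambert_moment_conv] free of the basis: on p = X^n it is
    that recurrence, and both sides are linear in p. It can thus be tested on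
    the powers of any affine polynomial. *)
Lemma moment_derivation p :
  ell ('X * p^`()) = 2^-1 * ell (Delta ('X * p)^`()).
Proof.
apply/eqP; rewrite -subr_eq0; apply/eqP; move: p.
apply: linear_poly0 => [c p q|n].
  rewrite derivD derivZ mulrDr -scalerAr mulrDr -scalerAr derivD derivZ.
  rewrite !(linearD, linearZ)/= !(linearD, linearZ)/= /GRing.scale/=; ring.
rewrite -exprS !derivXn; case: n => [|n] /=.
  rewrite !mulr0n mulr0 linear0 mulr1n poly_extendXn /quotient_mono big_ord0.
  by rewrite linear0 mulr0 subrr.
rewrite mulrnAr -exprS !raddfMn/= moment_polyXn poly_extendXn.
rewrite /quotient_mono linear_sum/= -[m n.+1 *+ _]mulr_natl lambert_moment_conv.
rewrite -[X in _ - _ * X]mulr_natl; apply/eqP; rewrite subr_eq0; apply/eqP.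
congr (_ * (_ * _)); apply: eq_bigr => i _.
by rewrite linearZ/= moment_polyXn.
Qed.

Variables beta gamma : F.
Local Notation Y := (beta%:P + gamma *: 'X).
Local Notation M := (fun n => ell (Y ^+ n)).

Lemma Delta_mulY p : Delta (Y * p) = Y * Delta p + (gamma * ell p)%:P.
Proof.
rewrite !mulrDl !mul_polyC -!scalerAl linearD !linearZ/= Delta_mulX.
by rewrite scalerDr addrA; congr (_ + _); rewrite -mul_polyC -polyCM.
Qed.

Lemma ell_DeltaY n :
  ell (Delta (Y ^+ n.+1)) = gamma * \sum_(i < n.+1) M (n - i)%N * M i.
Proof.
have -> : Delta (Y ^+ n.+1) = gamma *: \sum_(i < n.+1) M (n - i)%N *: Y ^+ i.
  elim: n => [|n IHn].
    rewrite expr1 -[Y]mulr1 Delta_mulY big_ord1 subnn !expr0 scale_polyC.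
    rewrite mulr1 scale_polyC (_ : Delta 1 = 0) ?mulr0 ?add0r//.
    by rewrite -(expr0 'X) poly_extendXn /quotient_mono big_ord0.
  rewrite exprS Delta_mulY {}IHn [in RHS]big_ord_recl subn0 expr0 scalerDr alg_polyC.
  rewrite scale_polyC addrC; congr (_ + _).
  rewrite -scalerAr mulr_sumr; congr (_ *: _); apply: eq_bigr => i _.
  by rewrite lift0 subSS exprS scalerAr.
rewrite linearZ/= /GRing.scale/= linear_sum; congr (_ * _); apply: eq_bigr => i _.
by rewrite linearZ.
Qed.

(** [moment_derivation] at p = Y^(n+1): both X Y' and Delta on powers of Y stay
    in the span of powers of Y, so the moments M of Y obey a recurrence of the
    same shape. *)
Lemma moment_recurrence n :
  n.+1%:R * (M n.+1 - beta * M n) = 2^-1 * gamma *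
    (n.+2%:R * (\sum_(i < n.+1) M (n - i)%N * M i)
     - beta * (n.+1%:R * \sum_(i < n) M (n.-1 - i)%N * M i)).
Proof.
have DY0 : ell (Delta (Y ^+ n)) = gamma * \sum_(i < n) M (n.-1 - i)%N * M i.
  case: n => [|n]; last exact: ell_DeltaY.
  rewrite expr0 big_ord0 mulr0 -(expr0 'X) poly_extendXn /quotient_mono big_ord0.
  by rewrite linear0.
have := moment_derivation (Y ^+ n.+1).
have dY : (Y ^+ n.+1)^`() = (n.+1%:R * gamma) *: Y ^+ n.
  rewrite deriv_exp derivD derivC derivZ derivX add0r alg_polyC mul_polyC.
  by rewrite -scaler_nat scalerA.
have XdY : 'X * (Y ^+ n.+1)^`() = n.+1%:R *: Y ^+ n.+1 - (n.+1%:R * beta) *: Y ^+ n.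
  rewrite dY exprS -!mul_polyC !polyCM; ring.
rewrite derivM derivX mul1r XdY.
have ellB c d p q : ell (c *: p - d *: q) = c * ell p - d * ell q.
  by rewrite linearB !linearZ.
have ellDB c d p q : ell (p + (c *: p - d *: q)) = ell p + (c * ell p - d * ell q).
  by rewrite -ellB linearD.
have DeltaDB c d p q : Delta (p + (c *: p - d *: q)) =
    Delta p + (c *: Delta p - d *: Delta q).
  by rewrite linearD linearB !linearZ.
rewrite ellB DeltaDB ellDB ell_DeltaY DY0 => H.
rewrite mulrBr [X in _ - X = _]mulrA H -[n.+2%:R]nat1r; ring.
Qed.

End MomentRecurrence.

(** * The modulus of a complex number *)

Section ComplexModulus.
Variable R : realType.
Implicit Types z w : R[i].

Lemma normc_ge0 z : 0 <= normc z.
Proof. by case: z => a b; rewrite sqrtr_ge0. Qed.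

Lemma normr_normc z : `|z| = (normc z)%:C.
Proof. by rewrite normc_def; case: z. Qed.

Lemma normc_real (x : R) : normc x%:C = `|x|.
Proof. by rewrite /= expr0n/= addr0 sqrtr_sqr. Qed.

Lemma normc_nat n : normc (n%:R : R[i]) = n%:R.
Proof. by rewrite -(rmorph_nat (real_complex R)) normc_real ger0_norm. Qed.

Lemma normcX z n : normc (z ^+ n) = normc z ^+ n.
Proof.
elim: n => [|n IHn]; first by rewrite !expr0 normc1.
by rewrite !exprS normcM IHn.
Qed.

Lemma normcB z w : normc (z - w) <= normc z + normc w.
Proof. by rewrite -(normcN w); exact: le_normcD. Qed.

Lemma le_normc_sum (I : Type) (s : seq I) (P : pred I) (f : I -> R[i]) :
  normc (\sum_(i <- s | P i) f i) <= \sum_(i <- s | P i) normc (f i).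
Proof.
elim/big_ind2 : _ => //; first by rewrite normc0.
by move=> x1 x2 y1 y2 h1 h2; apply: le_trans (le_normcD _ _) (lerD h1 h2).
Qed.

Lemma le_Re_normc z : `|complex.Re z| <= normc z.
Proof.
case: z => a b /=; rewrite -sqrtr_sqr ler_wsqrtr// lerDl sqr_ge0//.
Qed.

Lemma le_Im_normc z : `|complex.Im z| <= normc z.
Proof.
case: z => a b /=; rewrite -sqrtr_sqr ler_wsqrtr// lerDr sqr_ge0//.
Qed.

Lemma normc_le_ReIm z : normc z <= `|complex.Re z| + `|complex.Im z|.
Proof.
have {1}-> : z = (complex.Re z)%:C + (complex.Im z)%:C * 'i.
  by case: z => a b; apply/eqP; rewrite eq_complex /=; apply/andP; split; apply/eqP; ring.
apply: le_trans (le_normcD _ _) _; rewrite normcM !normc_real.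
by rewrite [normc 'i]/= expr0n expr1n add0r sqrtr1 mulr1.
Qed.

Lemma normc_eq0P z : normc z = 0 -> z = 0.
Proof. exact: eq0_normc. Qed.

End ComplexModulus.

(** * Complex null sequences *)

Section Vanishing.
Variable R : realType.
Implicit Types (e f : nat -> R[i]) (c z : R[i]).

Definition vanishing e : Prop := normc (e N) @[N --> \oo] --> (0 : R).

Lemma vanishing_le e (b : nat -> R) : (forall N, normc (e N) <= b N) ->
  b N @[N --> \oo] --> (0 : R) -> vanishing e.
Proof.
move=> eb b0; apply: (@squeeze_cvgr _ _ _ _ (fun=> 0) b) => //.
- by apply: nearW => N; rewrite normc_ge0 eb.
- exact: cvg_cst.
Qed.

Lemma vanishingD e f : vanishing e -> vanishing f ->
  vanishing (fun N => e N + f N).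
Proof.
move=> e0 f0; apply: (vanishing_le (b := fun N => normc (e N) + normc (f N))).
  by move=> N; exact: le_normcD.
by rewrite -[X in _ --> X](addr0 0); exact: cvgD.
Qed.

Lemma vanishingZ c e : vanishing e -> vanishing (fun N => c * e N).
Proof.
move=> e0; apply: (vanishing_le (b := fun N => normc c * normc (e N))).
  by move=> N; rewrite normcM.
by rewrite -[X in _ --> X](mulr0 (normc c)); exact: cvgMr.
Qed.

Lemma vanishingM e f : vanishing e -> vanishing f ->
  vanishing (fun N => e N * f N).
Proof.
move=> e0 f0; apply: (vanishing_le (b := fun N => normc (e N) * normc (f N))).
  by move=> N; rewrite normcM.
by rewrite -[X in _ --> X](mulr0 0); exact: cvgM.
Qed.

Lemma vanishingS e : vanishing e -> vanishing (fun N => e N.+1).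
Proof. by rewrite /vanishing (cvg_shiftS (fun N => normc (e N))). Qed.

(** An identity in R[i] that holds in the limit is proved by exhibiting its
    defect, a constant, as a null sequence. *)
Lemma vanishing_cst z : vanishing (fun=> z) -> z = 0.
Proof.
move=> z0; apply: normc_eq0P; apply/esym.
by apply: (cvg_unique _ z0) => //; exact: cvg_cst.
Qed.

(** With s the fourth root of q, (N+1) s^N <= 1 + s + .. + s^N is bounded, so
    (N+1)^2 q^N is at most a constant times (s^2)^N. *)
Lemma cvg_sqrn_expr (q : R) : 0 <= q < 1 ->
  N.+1%:R ^+ 2 * q ^+ N @[N --> \oo] --> (0 : R).
Proof.
move=> /andP[q0 q1]; pose s := Num.sqrt (Num.sqrt q).
have s0 : 0 <= s by rewrite sqrtr_ge0.
have s1 : s < 1.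
  by rewrite -[ltRHS](@sqrtr1 R) ltr_sqrt// -[ltRHS](@sqrtr1 R) ltr_sqrt.
have sq : q = s ^+ 4.
  by rewrite (exprM s 2 2) !sqr_sqrtr ?sqrtr_ge0.
have sV : 0 < 1 - s by lra.
have Ns N : N.+1%:R * s ^+ N <= (1 - s)^-1.
  rewrite -[leRHS]mul1r ler_pdivlMr//.
  have -> : N.+1%:R * s ^+ N = \sum_(k < N.+1) s ^+ N.
    by rewrite sumr_const card_ord mulr_natl.
  apply: (@le_trans _ _ ((\sum_(k < N.+1) s ^+ k) * (1 - s))).
    apply: ler_wpM2r; first exact: ltW.
    apply: ler_sum => k _.
    by apply: ler_wiXn2l => //; [exact: ltW|rewrite -ltnS].
  have := subrXX 1 s N.+1; rewrite expr1n mulrC.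
  rewrite (eq_bigr (fun k : 'I_N.+1 => s ^+ k)); last by move=> k _; rewrite expr1n mul1r.
  by rewrite mulrC => <-; rewrite gerBl exprn_ge0.
apply: (@squeeze_cvgr _ _ _ _ (fun=> 0) (fun N => (1 - s)^-1 ^+ 2 * (s ^+ 2) ^+ N)).
- apply: nearW => N; apply/andP; split.
    by rewrite mulr_ge0 ?exprn_ge0.
  have -> : N.+1%:R ^+ 2 * q ^+ N = (N.+1%:R * s ^+ N) ^+ 2 * (s ^+ 2) ^+ N.
    by rewrite sq [in RHS]exprMn -[RHS]mulrA -!exprM -exprD; congr (_ * _ ^+ _); lia.
  apply: ler_wpM2r; first by rewrite !exprn_ge0.
  have sN0 : 0 <= N.+1%:R * s ^+ N by rewrite mulr_ge0 ?exprn_ge0.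
  by rewrite lerXn2r// nnegrE ?invr_ge0// ltW.
- exact: cvg_cst.
- rewrite -[X in _ --> X](mulr0 ((1 - s)^-1 ^+ 2)); apply: cvgMr; apply: cvg_expr.
  by rewrite ger0_norm ?sqr_ge0// expr_lt1.
Qed.

Lemma vanishing_geometric (K q : R) e : 0 <= q < 1 ->
  (forall N, normc (e N) <= K * (N.+1%:R ^+ 2 * q ^+ N)) -> vanishing e.
Proof.
move=> q01 eK; apply: (vanishing_le eK).
by rewrite -[X in _ --> X](mulr0 K); apply: cvgMr; exact: cvg_sqrn_expr.
Qed.

End Vanishing.

(** * Moment functionals on real and complex functions *)

Section FunctionalTheory.
Variables (R : realType) (B : R) (m : nat -> R) (L : (R -> R) -> R).
Hypothesis hL : moment_functional B m L.
Implicit Types (f g : R -> R).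

Lemma bounded_upto_cst (c : R) : bounded_upto B (fun=> c).
Proof. by exists `|c|. Qed.

Lemma bounded_uptoZD (c : R) f g : bounded_upto B f -> bounded_upto B g ->
  bounded_upto B (fun t => c * f t + g t).
Proof.
move=> [M fM] [N gN]; exists (`|c| * M + N) => t tB.
apply: le_trans (ler_normD _ _) _; rewrite normrM.
by rewrite lerD ?ler_wpM2l ?fM ?gN.
Qed.

Lemma mfunct0 : L (fun=> 0) = 0.
Proof.
have b0 := bounded_upto_cst 0.
have := mfunct_linear hL 1 b0 b0; rewrite mulr0 addr0 mul1r.
by move/esym/eqP; rewrite -subr_eq0 addrK => /eqP.
Qed.

Lemma mfunctB f g : bounded_upto B f -> bounded_upto B g ->
  L (fun t => f t - g t) = L f - L g.
Proof.
move=> bf bg; rewrite -[RHS]addrC -mulN1r -(mfunct_linear hL)//.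
by congr L; apply/funext => t; rewrite mulN1r addrC.
Qed.

Lemma mfunct1 : L (fun=> 1) = m 0%N.
Proof.
by rewrite -(mfunct_moment hL 0%N); congr L; apply/funext => t; rewrite expr0.
Qed.

Lemma mfunct_cst (c : R) : L (fun=> c) = c * m 0%N.
Proof.
have := mfunct_linear hL c (bounded_upto_cst 1) (bounded_upto_cst 0).
by rewrite mfunct1 mfunct0 mulr1 !addr0.
Qed.

Lemma mfunct_le f g : bounded_upto B f -> bounded_upto B g ->
  (forall t, 0 <= t <= B -> f t <= g t) -> L f <= L g.
Proof.
move=> bf bg fg; rewrite -subr_ge0 -mfunctB//; apply: (mfunct_ge0 hL).
  have [M] := bounded_uptoZD (-1) bf bg; move=> fM; exists M => t tB.
  by have := fM t tB; rewrite mulN1r addrC.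
by move=> t tB; rewrite subr_ge0 fg.
Qed.

Lemma mfunct_norm f (M : R) : (forall t, 0 <= t <= B -> `|f t| <= M) ->
  `|L f| <= M * m 0%N.
Proof.
move=> fM; have bf : bounded_upto B f by exists M.
rewrite ler_norml -mulNr -!mfunct_cst; apply/andP; split;
  apply: mfunct_le => //; try exact: bounded_upto_cst;
  by move=> t /fM; rewrite ler_norml => /andP[].
Qed.

Lemma mfunct_ext f g : bounded_upto B f ->
  (forall t, 0 <= t <= B -> f t = g t) -> L f = L g.
Proof.
move=> bf fg.
have bg : bounded_upto B g.
  by have [M fM] := bf; exists M => t tB; rewrite -fg// fM.
by apply/eqP; rewrite eq_le !mfunct_le// => t tB; rewrite fg.
Qed.

Definition cbounded_upto (f : R -> R[i]) : Prop :=
  exists M : R, forall t : R, 0 <= t <= B -> normc (f t) <= M.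

Definition cfunct (f : R -> R[i]) : R[i] :=
  L (fun t => complex.Re (f t)) +i* L (fun t => complex.Im (f t)).

Lemma cbounded_Re (f : R -> R[i]) : cbounded_upto f ->
  bounded_upto B (fun t => complex.Re (f t)).
Proof.
by move=> [M fM]; exists M => t /fM; apply: le_trans; exact: le_Re_normc.
Qed.

Lemma cbounded_Im (f : R -> R[i]) : cbounded_upto f ->
  bounded_upto B (fun t => complex.Im (f t)).
Proof.
by move=> [M fM]; exists M => t /fM; apply: le_trans; exact: le_Im_normc.
Qed.

Lemma cbounded_uptoZD (c : R[i]) (f g : R -> R[i]) :
  cbounded_upto f -> cbounded_upto g ->
  cbounded_upto (fun t => c * f t + g t).
Proof.
move=> [M fM] [N gN]; exists (normc c * M + N) => t tB.
apply: le_trans (le_normcD _ _) _; rewrite normcM.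
by rewrite lerD ?ler_wpM2l ?normc_ge0 ?fM ?gN.
Qed.

Lemma cbounded_uptoM (f g : R -> R[i]) :
  cbounded_upto f -> cbounded_upto g -> cbounded_upto (fun t => f t * g t).
Proof.
move=> [M fM] [N gN]; exists (M * N) => t tB.
by rewrite normcM ler_pM ?normc_ge0 ?fM ?gN.
Qed.

Lemma cbounded_upto_cst (c : R[i]) : cbounded_upto (fun=> c).
Proof. by exists (normc c). Qed.

Lemma cfunct_linear (c : R[i]) (f g : R -> R[i]) :
  cbounded_upto f -> cbounded_upto g ->
  cfunct (fun t => c * f t + g t) = c * cfunct f + cfunct g.
Proof.
move=> bf bg; case: c => a b.
have [rf rg] := (cbounded_Re bf, cbounded_Re bg).
have [jf jg] := (cbounded_Im bf, cbounded_Im bg).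
apply/eqP; rewrite eq_complex /=; apply/andP; split; apply/eqP.
  rewrite -addrA -mulNr -(mfunct_linear hL)//.
  rewrite -(mfunct_linear hL)//; last exact: bounded_uptoZD.
  congr L; apply/funext => t; case: (f t) => x y; case: (g t) => u v /=; ring.
rewrite -addrA -(mfunct_linear hL)//.
rewrite -(mfunct_linear hL)//; last exact: bounded_uptoZD.
congr L; apply/funext => t; case: (f t) => x y; case: (g t) => u v /=; ring.
Qed.

(** The real and imaginary parts are estimated separately, which costs the
    factor 2. *)
Lemma cfunct_norm (f : R -> R[i]) (M : R) :
  (forall t, 0 <= t <= B -> normc (f t) <= M) ->
  normc (cfunct f) <= 2 * (M * m 0%N).
Proof.
move=> fM; apply: le_trans (normc_le_ReIm _) _ => /=.
rewrite [2 * _]mulrDl !mul1r; apply: lerD; apply: mfunct_norm => t /fM; apply: le_trans.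
  exact: le_Re_normc.
exact: le_Im_normc.
Qed.

Lemma cfunct_ext (f g : R -> R[i]) : cbounded_upto f ->
  (forall t, 0 <= t <= B -> f t = g t) -> cfunct f = cfunct g.
Proof.
move=> bf fg; congr (_ +i* _); apply: mfunct_ext.
- exact: cbounded_Re.
- by move=> t tB; rewrite fg.
- exact: cbounded_Im.
- by move=> t tB; rewrite fg.
Qed.

Lemma cfunct0 : cfunct (fun=> 0) = 0.
Proof. by rewrite /cfunct /= mfunct0. Qed.

Lemma cfunctZ (c : R[i]) (f : R -> R[i]) : cbounded_upto f ->
  cfunct (fun t => c * f t) = c * cfunct f.
Proof.
move=> bf; rewrite -[RHS]addr0 -cfunct0 -cfunct_linear//; last exact: cbounded_upto_cst.
by congr cfunct; apply/funext => t; rewrite addr0.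
Qed.

Lemma cfunctD (f g : R -> R[i]) : cbounded_upto f -> cbounded_upto g ->
  cfunct (fun t => f t + g t) = cfunct f + cfunct g.
Proof.
move=> bf bg; rewrite -[X in _ = X + _]mul1r -cfunct_linear//.
by congr cfunct; apply/funext => t; rewrite mul1r.
Qed.

Lemma cbounded_upto_sum n (f : nat -> R -> R[i]) :
  (forall i, cbounded_upto (f i)) ->
  cbounded_upto (fun t => \sum_(i < n) f i t).
Proof.
move=> bf; elim: n => [|n [M IHn]].
  by exists 0 => t _; rewrite big_ord0 normc0.
have [N fN] := bf n; exists (M + N) => t tB; rewrite big_ord_recr/=.
by apply: le_trans (le_normcD _ _) _; rewrite lerD ?IHn ?fN.
Qed.

Lemma cfunct_sum n (f : nat -> R -> R[i]) :
  (forall i, cbounded_upto (f i)) ->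
  cfunct (fun t => \sum_(i < n) f i t) = \sum_(i < n) cfunct (f i).
Proof.
move=> bf; elim: n => [|n IHn].
  by rewrite big_ord0 -[RHS]cfunct0; congr cfunct; apply/funext => t; rewrite big_ord0.
rewrite big_ord_recr/= -IHn -cfunctD//; last exact: cbounded_upto_sum.
by congr cfunct; apply/funext => t; rewrite big_ord_recr.
Qed.

Hypothesis B0 : 0 <= B.

Lemma cbounded_upto_id n : cbounded_upto (fun t => t%:C ^+ n).
Proof.
exists (B ^+ n) => t /andP[t0 tB].
by rewrite normcX normc_real ger0_norm// lerXn2r.
Qed.

Lemma cfunct_horner (p : {poly R[i]}) :
  cfunct (fun t => p.[t%:C]) = moment_poly (fun n => (m n)%:C) p.
Proof.
pose f i t := p`_i * t%:C ^+ i.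
have -> : (fun t : R => p.[t%:C]) = (fun t => \sum_(i < size p) f i t).
  by apply/funext => t; rewrite horner_coef.
have bX i := cbounded_upto_id i.
rewrite cfunct_sum => [|i]; last exact: cbounded_uptoM (cbounded_upto_cst _) (bX i).
apply: eq_bigr => i _; rewrite cfunctZ//; congr (_ * _).
rewrite /cfunct -(mfunct_moment hL) -[RHS]complexr0 -[in RHS]mfunct0.
have rX t : (t%:C : R[i]) ^+ i = (t ^+ i)%:C by rewrite rmorphXn.
by congr (_ +i* _); congr L; apply/funext => t; rewrite rX.
Qed.

End FunctionalTheory.

(** * Geometry of the slit plane *)

Section SlitPlane.
Variable R : realType.
Implicit Types z d : R[i].

(** If Im z is nonzero, some d of real part 1 makes Re (d z) = 0; otherwise
    z > 0 and d = 1 does. So the half-line 1 + t z, which avoids 0, lies in a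
    half-plane. *)
Lemma slit_plane_direction z : slit_plane 0 z ->
  exists d : R[i], forall t : R, 0 <= t -> 1 <= complex.Re (d * (1 + t%:C * z)).
Proof.
case: z => x y /= zP; have [y0|y0] := eqVneq y 0.
  have x0 : 0 < x by rewrite ltNge; apply/negP => x0; exact: zP.
  exists 1 => t t0; rewrite y0 /= (_ : _ - _ = 1 + t * x); last by ring.
  by rewrite lerDl mulr_ge0// ltW.
(* The imaginary part of d is chosen so that Re (d z) = x - (x / y) y = 0. *)
exists (1 +i* (x / y)) => t t0 /=.
rewrite (_ : _ - _ = 1)//; first by field.
Qed.

Lemma slit_plane_normc_ge z : slit_plane 0 z ->
  exists2 c : R, 0 < c & forall t : R, 0 <= t -> c <= normc (1 + t%:C * z).
Proof.
move=> /slit_plane_direction[d dP].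
have dn (t : R) : 0 <= t -> 1 <= normc d * normc (1 + t%:C * z).
  move=> /dP; rewrite -normcM => h; apply: le_trans h _.
  by apply: le_trans (le_Re_normc _); exact: ler_norm.
have d0 : 0 < normc d.
  rewrite lt_neqAle normc_ge0 andbT; apply/eqP => d0.
  by have := dn 0 (lexx 0); rewrite -d0 mul0r ler10.
exists (normc d)^-1 => [|t /dn]; first by rewrite invr_gt0.
by rewrite -ler_pdivrMl// mulr1.
Qed.

(** For alpha a small multiple of the direction d above, alpha (1 + t z) has
    positive real part, bounded below by eps, and squared modulus of order
    eps^2. So 1 - alpha (1 + t z) is a contraction, uniformly on [0, B]. *)
Lemma slit_plane_contraction z (B : R) : slit_plane 0 z -> 0 <= B ->
  exists alpha : R[i], exists2 q : R, 0 <= q < 1 &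
    forall t : R, 0 <= t <= B -> normc (1 - alpha * (1 + t%:C * z)) <= q.
Proof.
move=> /slit_plane_direction[d dP] B0.
(* K bounds |d (1 + t z)|^2 on [0, B]; the scale 1/K makes the quadratic term
   at most half of the linear one in |1 - d (1 + t z)/K|^2. *)
pose K : R := (normc d * (1 + B * normc z)) ^+ 2 + 1.
have K1 : 1 <= K by rewrite lerDr sqr_ge0.
have K0 : 0 < K by lra.
have KV : K^-1 <= 1 by rewrite invf_le1.
have KV0 : 0 < K^-1 by rewrite invr_gt0.
exists ((K^-1)%:C * d), (Num.sqrt (1 - K^-1)).
  rewrite sqrtr_ge0/= -[ltRHS]sqrtr1 ltr_sqrt//; lra.
move=> t /andP[t0 tB]; rewrite -mulrA.
have := dP t t0; have : normc (d * (1 + t%:C * z)) ^+ 2 <= K.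
  apply: (@le_trans _ _ ((normc d * (1 + B * normc z)) ^+ 2)); last by rewrite lerDl.
  rewrite lerXn2r ?nnegrE ?normc_ge0// ?mulr_ge0 ?addr_ge0 ?mulr_ge0 ?normc_ge0//.
  rewrite normcM ler_wpM2l ?normc_ge0//; apply: le_trans (le_normcD _ _) _.
  by rewrite normc1 lerD// normcM normc_real ger0_norm// ler_wpM2r ?normc_ge0.
case: (d * _) => a b; rewrite [normc (a +i* b)]/= sqr_sqrtr ?addr_ge0 ?sqr_ge0//.
move=> abK a1; rewrite /= ler_wsqrtr//.
move: (K^-1) KV0 (mulVf (lt0r_neq0 K0)) => k k0 kK.
have k2 : k ^+ 2 * (a ^+ 2 + b ^+ 2) <= k.
  apply: (@le_trans _ _ (k ^+ 2 * K)); first by rewrite ler_wpM2l ?sqr_ge0.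
  by rewrite expr2 -mulrA kK mulr1.
have k3 : k <= k * a by rewrite ler_peMr// ltW.
rewrite !mul0r !subr0 !addr0 sub0r sqrrN.
have -> : (1 - k * a) ^+ 2 + (k * b) ^+ 2 =
    1 - 2 * (k * a) + k ^+ 2 * (a ^+ 2 + b ^+ 2) by ring.
lra.
Qed.

End SlitPlane.

(** * Partial sums of a convolution *)

Section TriangularSums.
Variable F : comNzRingType.
Implicit Types (u v : nat -> F).

Lemma sum_convolution u v N :
  \sum_(n < N) \sum_(i < n.+1) u i * v (n - i)%N =
  \sum_(i < N) u i * \sum_(j < N - i) v j.
Proof.
elim: N => [|N IHN]; first by rewrite !big_ord0.
rewrite big_ord_recr/= IHN [in RHS]big_ord_recr/= subSnn big_ord1.
rewrite big_ord_recr/= subnn addrA; congr (_ + _); rewrite -big_split/=.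
apply: eq_bigr => i _; rewrite -mulrDr; congr (_ * _).
by rewrite subSn ?big_ord_recr// ltnW.
Qed.

(** Replacing i by n - i symmetrises the weight i+1 into (n+2)/2. *)
Lemma convolution_weight v n :
  n.+2%:R * (\sum_(i < n.+1) v (n - i)%N * v i) =
  2 * \sum_(i < n.+1) (i.+1%:R * v i) * v (n - i)%N.
Proof.
rewrite [2 * _]mulrDl mul1r.
rewrite [X in _ = X + _](reindex_inj rev_ord_inj)/= -big_split/= mulr_sumr.
apply: eq_bigr => i _; rewrite subSS.
have iN : (i <= n)%N by rewrite -ltnS.
have -> : n.+2%:R = (n - i).+1%:R + i.+1%:R :> F.
  by rewrite -natrD addSn addnS subnK.
rewrite subKn//; ring.
Qed.

End TriangularSums.

(** * The functional equation by a convergent expansion *)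

Section ResolventEquation.
Variables (R : realType) (B : R) (L : (R -> R) -> R).
Hypothesis hL : moment_functional B (@lambert_moment R) L.
Hypothesis B0 : 0 <= B.
Variables (alpha z : R[i]) (q : R).
Hypothesis q01 : 0 <= q < 1.
Local Notation y t := (1 - alpha * (1 + t%:C * z)).
Hypothesis yq : forall t : R, 0 <= t <= B -> normc (y t) <= q.

Local Notation E := (cfunct L).
Local Notation beta := (1 - alpha).
Local Notation gamma := (- (alpha * z)).
Local Notation M n := (moment_poly lambert_moment
  ((beta%:P + gamma *: 'X) ^+ n)).
Local Notation U n := (n.+1%:R * M n).
Local Notation A := (E (fun t => (1 - y t)^-1)).
Local Notation V := (E (fun t => (1 - y t)^-2)).

Lemma lambert_moment0 (F : numFieldType) : lambert_moment 0 = 1 :> F.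
Proof. by rewrite /lambert_moment expr0 divr1. Qed.

Lemma cfunct_normc_le (f : R -> R[i]) (K : R) :
  (forall t, 0 <= t <= B -> normc (f t) <= K) -> normc (E f) <= 2 * K.
Proof. by move=> /(cfunct_norm hL); rewrite lambert_moment0 mulr1. Qed.

Lemma contraction_neq0 t : 0 <= t <= B -> 1 - y t != 0.
Proof.
move=> /yq; apply: contraTneq => h; rewrite -ltNge.
have -> : y t = 1 by apply/eqP; rewrite -subr_eq0 -opprB h oppr0.
by rewrite normc1; case/andP: q01.
Qed.

Lemma contraction_inv t : 0 <= t <= B -> normc (1 - y t)^-1 <= (1 - q)^-1.
Proof.
move=> tB; have /andP[q0 q1] := q01; rewrite normcV.
have h : 1 - q <= normc (1 - y t).
  rewrite lerBlDr; apply: le_trans (lerD (lexx _) (yq tB)).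
  by rewrite -{1}[1](@normc1 R) -{1}[1](subrK (y t)) le_normcD.
have q1' : 0 < 1 - q by lra.
by rewrite lef_pV2// posrE (lt_le_trans q1').
Qed.

Lemma contraction_pow_bounded n : cbounded_upto B (fun t => y t ^+ n).
Proof.
exists (q ^+ n) => t /yq h; have /andP[q0 q1] := q01.
by rewrite normcX lerXn2r ?nnegrE ?normc_ge0.
Qed.

Lemma contraction_inv_bounded n : cbounded_upto B (fun t => (1 - y t) ^- n).
Proof.
exists ((1 - q)^-1 ^+ n) => t /contraction_inv h; have /andP[q0 q1] := q01.
rewrite -exprVn normcX lerXn2r ?nnegrE ?normc_ge0// invr_ge0; lra.
Qed.

(** The algebraic moments of the affine polynomial are the values of the
    functional on powers of the contraction. *)
Lemma resolvent_momentE n : M n = E (fun t => y t ^+ n).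
Proof.
have -> : (fun t => y t ^+ n) =
    (fun t => ((beta%:P + gamma *: 'X) ^+ n).[t%:C]).
  apply/funext => t; rewrite horner_exp hornerD hornerC hornerZ hornerX.
  by congr (_ ^+ _); ring.
rewrite (cfunct_horner hL)//; apply: eq_bigr => i _; congr (_ *: _).
by rewrite /lambert_moment fmorph_div rmorphXn !rmorph_nat.
Qed.

Lemma resolvent_moment_norm n : normc (M n) <= 2 * q ^+ n.
Proof.
rewrite resolvent_momentE; apply: cfunct_normc_le => t /yq h.
by have /andP[q0 q1] := q01; rewrite normcX lerXn2r ?nnegrE ?normc_ge0.
Qed.

(** The sum of M n is the geometric series of (1 - y)^-1, whose remainder is
    y^N (1 - y)^-1. *)
Lemma geometric_remainder N :
  normc (A - \sum_(n < N) M n) <= 2 * (1 - q)^-1 * q ^+ N.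
Proof.
have /andP[q0 q1] := q01.
have bS : cbounded_upto B (fun t => \sum_(n < N) y t ^+ n).
  exact: (cbounded_upto_sum _ contraction_pow_bounded).
have b1 := contraction_inv_bounded 1.
have -> : A - \sum_(n < N) M n = E (fun t => (1 - y t)^-1 * y t ^+ N).
  rewrite addrC -mulN1r (eq_bigr (fun n : 'I_N => E (fun t => y t ^+ n))); last first.
    by move=> n _; exact: resolvent_momentE.
  rewrite -(cfunct_sum hL _ contraction_pow_bounded) -(cfunct_linear hL)//.
  apply: (cfunct_ext hL); first exact: cbounded_uptoZD.
  move=> t /contraction_neq0 h; have := subrXX 1 (y t) N; rewrite expr1n.
  rewrite (eq_bigr (fun k : 'I_N => y t ^+ k)); last by move=> k _; rewrite expr1n mul1r.
  move: (y t : R[i]) (\sum_(_ < _) _ : R[i]) h => u S h /eqP; rewrite subr_eq => /eqP uN.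
  have -> : u ^+ N = 1 - (1 - u) * S.
    by apply/eqP; rewrite eq_sym subr_eq addrC -uN.
  by field.
rewrite -mulrA; apply: cfunct_normc_le => t tB.
rewrite normcM ler_pM ?normc_ge0 ?contraction_inv//.
by rewrite normcX lerXn2r ?nnegrE ?normc_ge0// yq.
Qed.

(** The sum of (n+1) M n is the series of (1 - y)^-2, with remainder
    y^N (N + 1 - N y) (1 - y)^-2. *)
Lemma weighted_remainder N :
  normc (V - \sum_(n < N) U n) <= 2 * (2 * (1 - q)^-2) * (N.+1%:R * q ^+ N).
Proof.
have /andP[q0 q1] := q01.
have bU n : cbounded_upto B (fun t => n.+1%:R * y t ^+ n).
  exact: cbounded_uptoM (cbounded_upto_cst _ _) (contraction_pow_bounded n).
have bS : cbounded_upto B (fun t => \sum_(n < N) n.+1%:R * y t ^+ n).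
  exact: (cbounded_upto_sum _ bU).
have b2 := contraction_inv_bounded 2.
have -> : V - \sum_(n < N) U n =
    E (fun t => (1 - y t)^-2 * (y t ^+ N * (N.+1%:R - N%:R * y t))).
  rewrite addrC -mulN1r (eq_bigr (fun n : 'I_N => E (fun t => n.+1%:R * y t ^+ n))); last first.
    move=> n _; rewrite resolvent_momentE (cfunctZ hL)//.
    exact: contraction_pow_bounded.
  rewrite -(cfunct_sum hL _ bU) -(cfunct_linear hL)//.
  apply: (cfunct_ext hL); first exact: cbounded_uptoZD.
  move=> t /contraction_neq0 h.
  have H : (1 - y t) ^+ 2 * \sum_(n < N) n.+1%:R * y t ^+ n =
      1 - y t ^+ N * (N.+1%:R - N%:R * y t).
    move: (y t : R[i]) {h} => u; elim: N {bS} => [|N IHN].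
      by rewrite big_ord0 mulr0 expr0 mul0r subr0 mul1r subrr.
    by rewrite big_ord_recr/= mulrDr IHN [u ^+ N.+1]exprS; ring.
  move: (y t : R[i]) h H => u h H.
  apply: (mulfI (expf_neq0 2 h)); rewrite mulrDr mulrCA H mulrA mulfV ?expf_neq0//.
  by rewrite mul1r; ring.
have -> : 2 * (2 * (1 - q)^-2) * (N.+1%:R * q ^+ N) =
    2 * ((1 - q)^-1 ^+ 2 * (q ^+ N * (2 * N.+1%:R))) by rewrite exprVn; ring.
apply: cfunct_normc_le => t tB.
have qV0 : 0 <= (1 - q)^-1 by rewrite invr_ge0; lra.
rewrite normcM ler_pM ?normc_ge0//.
  by rewrite -exprVn normcX lerXn2r ?nnegrE ?normc_ge0 ?contraction_inv.
rewrite normcM ler_pM ?normc_ge0//.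
  by rewrite normcX lerXn2r ?nnegrE ?normc_ge0 ?yq.
apply: le_trans (normcB _ _) _; rewrite normcM !normc_nat mulrDl mul1r lerD//.
apply: (@le_trans _ _ N%:R); last by rewrite ler_nat.
by apply: ler_piMr => //; exact: le_trans (yq tB) (ltW q1).
Qed.

(** Mertens' argument with explicit rates: V A minus the triangular sum is
    (V - sum U) A + sum_i U_i (A - partial sum of M), and each of the N terms of
    the last sum is of order N q^N. *)
Lemma convolution_remainder N :
  normc (V * A - \sum_(i < N) U i * \sum_(j < N - i) M j) <=
  (4 * (1 - q)^-2 * normc A + 4 * (1 - q)^-1) * (N.+1%:R ^+ 2 * q ^+ N).
Proof.
have /andP[q0 q1] := q01.
have qV0 : 0 <= (1 - q)^-1 by rewrite invr_ge0; lra.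
have -> : V * A - \sum_(i < N) U i * \sum_(j < N - i) M j =
    (V - \sum_(i < N) U i) * A +
    \sum_(i < N) U i * (A - \sum_(j < N - i) M j).
  rewrite mulrBl [X in _ = _ + X](eq_bigr (fun i : 'I_N =>
    U i * A - U i * \sum_(j < N - i) M j)); last by move=> i _; rewrite mulrBr.
  by rewrite sumrB -mulr_suml addrA subrK.
have N1 : 1 <= N.+1%:R :> R by rewrite ler1n.
have qN : 0 <= q ^+ N by rewrite exprn_ge0.
apply: le_trans (le_normcD _ _) _; rewrite [leRHS]mulrDl; apply: lerD.
  rewrite normcM mulrAC; apply: ler_wpM2r; first exact: normc_ge0.
  apply: le_trans (weighted_remainder N) _.
  rewrite (_ : 2 * _ = 4 * (1 - q)^-2); last by ring.
  apply: ler_wpM2l; first by rewrite mulr_ge0// invr_ge0 exprn_ge0; lra.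
  apply: ler_wpM2r => //; rewrite expr2 ler_peMr//; lra.
apply: le_trans (le_normc_sum _ _ _) _.
apply: (@le_trans _ _ (\sum_(i < N) (4 * (1 - q)^-1 * (N.+1%:R * q ^+ N)))).
  apply: ler_sum => i _.
  have -> : 4 * (1 - q)^-1 * (N.+1%:R * q ^+ N) =
      (N.+1%:R * (2 * q ^+ i)) * (2 * (1 - q)^-1 * q ^+ (N - i)).
    have -> : q ^+ N = q ^+ i * q ^+ (N - i) by rewrite -exprD subnKC// ltnW.
    by ring.
  rewrite normcM ler_pM ?normc_ge0//; last exact: geometric_remainder.
  rewrite normcM normc_nat ler_pM ?normc_ge0 ?resolvent_moment_norm// ler_nat.
  by rewrite ltnW// ltnS.
rewrite sumr_const card_ord -[leLHS]mulr_natl.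
have -> : 4 * (1 - q)^-1 * (N.+1%:R ^+ 2 * q ^+ N) =
    N.+1%:R * (4 * (1 - q)^-1 * (N.+1%:R * q ^+ N)) by ring.
by apply: ler_wpM2r; [rewrite !mulr_ge0|rewrite ler_nat].
Qed.

(** The sum over n of [moment_recurrence]; weights n+2 on a convolution become
    weights i+1 on one factor by [convolution_weight]. *)
Lemma resolvent_partial_sums n :
  (\sum_(k < n.+2) U k - \sum_(k < n.+2) M k) - beta * \sum_(k < n.+1) U k =
  gamma * (\sum_(i < n.+1) U i * \sum_(j < n.+1 - i) M j
           - beta * \sum_(i < n) U i * \sum_(j < n - i) M j).
Proof.
have -> : \sum_(k < n.+2) U k - \sum_(k < n.+2) M k =
    \sum_(k < n.+1) k.+1%:R * M k.+1.
  rewrite -sumrB big_ord_recl mul1r subrr add0r; apply: eq_bigr => k _.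
  by rewrite lift0 -[k.+2%:R]natr1 mulrDl mul1r addrK.
rewrite mulr_sumr -sumrB.
rewrite (eq_bigr (fun k : 'I_n.+1 => k.+1%:R * (M k.+1 - beta * M k))); last first.
  by move=> k _; rewrite mulrBr mulrCA.
under eq_bigr do rewrite moment_recurrence.
rewrite -mulr_sumr sumrB -mulr_sumr.
rewrite [X in _ - beta * X]big_ord_recl big_ord0 mulr0 add0r.
have tri K : \sum_(i < K) U i * \sum_(j < K - i) M j =
    \sum_(k < K) \sum_(i < k.+1) U i * M (k - i)%N.
  by rewrite -(sum_convolution (fun i => U i) (fun j => M j)).
rewrite !tri.
have conv K : \sum_(k < K) k.+2%:R * (\sum_(i < k.+1) M (k - i)%N * M i) =
    2 * \sum_(k < K) \sum_(i < k.+1) U i * M (k - i)%N.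
  rewrite mulr_sumr; apply: eq_bigr => k _.
  exact: (convolution_weight (fun i => M i)).
rewrite conv (eq_bigr (fun k : 'I_n => k.+2%:R * (\sum_(i < k.+1) M (k - i)%N * M i))); last first.
  by move=> k _; rewrite lift0.
rewrite conv.
move: (\sum_(k < n.+1) \sum_(i < k.+1) _) (\sum_(k < n) \sum_(i < k.+1) _) => P P'.
by field.
Qed.

(** The limit of [resolvent_partial_sums]. The two sides differ by a fixed
    combination of the three remainders, which is therefore a null sequence that
    is also constant. *)
Lemma resolvent_equation :
  (V - A) - beta * V = gamma * (1 - beta) * (V * A).
Proof.
apply/eqP; rewrite -subr_eq0; apply/eqP/vanishing_cst.
pose eA N := A - \sum_(k < N) M k.
pose eV N := V - \sum_(k < N) U k.
pose eW N := V * A - \sum_(i < N) U i * \sum_(j < N - i) M j.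
have /andP[q0 q1] := q01.
have qN N : 0 <= q ^+ N by rewrite exprn_ge0.
have N1 N : 1 <= N.+1%:R :> R by rewrite ler1n.
have vA : vanishing eA.
  apply: (vanishing_geometric (K := 2 * (1 - q)^-1) q01) => N.
  apply: le_trans (geometric_remainder N) _; apply: ler_wpM2l.
    by rewrite mulr_ge0// invr_ge0; lra.
  by rewrite ler_peMl// exprn_ege1.
have vV : vanishing eV.
  apply: (vanishing_geometric (K := 2 * (2 * (1 - q)^-2)) q01) => N.
  apply: le_trans (weighted_remainder N) _; apply: ler_wpM2l.
    by rewrite !mulr_ge0// invr_ge0 exprn_ge0; lra.
  by apply: ler_wpM2r => //; rewrite expr2 ler_peMr//; have := N1 N; lra.
have vW : vanishing eW by exact: vanishing_geometric q01 convolution_remainder.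
rewrite (_ : (fun=> _) = fun n => (eV n.+2 + (-1) * eA n.+2)
    + ((- beta) * eV n.+1 + ((- gamma) * eW n.+1 + (gamma * beta) * eW n))).
  have vA2 := vanishingZ (-1) (vanishingS (vanishingS vA)).
  have vV2 := vanishingD (vanishingS (vanishingS vV)) vA2.
  apply: (vanishingD vV2).
  apply: (vanishingD (vanishingZ (- beta) (vanishingS vV))).
  by apply: (vanishingD (vanishingZ (- gamma) (vanishingS vW))); exact: vanishingZ.
apply/funext => n; rewrite /eA /eV /eW.
have := resolvent_partial_sums n.
move: A V (\sum_(k < n.+2) U k) (\sum_(k < n.+2) M k) (\sum_(k < n.+1) U k).
move: (\sum_(i < n.+1) _) (\sum_(i < n) _) => P P' a v s1 s2 s3 H.
have -> : s1 = gamma * (P - beta * P') + beta * s3 + s2.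
  by rewrite -H; ring.
by ring.
Qed.

End ResolventEquation.

(** * Derivatives of real functions *)

Section RealCalculus.
Variable R : realType.

(** A quadratic remainder is all that the estimates of the transform provide,
    and it suffices for differentiability. *)
Lemma is_derive_of_taylor (f : R -> R) (x l K d : R) : 0 < d ->
  (forall s, `|s - x| < d -> `|f s - f x - (s - x) * l| <= K * (s - x) ^+ 2) ->
  is_derive x 1 f l.
Proof.
move=> d0 fK.
(* The difference quotient, completed by its limit (Caratheodory). *)
pose g s := if s == x then l else (f s - f x) / (s - x).
apply/is_derive1_caratheodory; exists g; split; last by rewrite /g eqxx.
  move=> s; rewrite /g; case: eqVneq => [->|sx]; first by rewrite !subrr mulr0.
  by rewrite divfK// subr_eq0.
have gK s : `|s - x| < d -> `|g s - l| <= `|K| * `|s - x|.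
  move=> sd; rewrite /g; case: eqVneq => [->|sx].
    by rewrite !subrr normr0 mulr0.
  have sx0 : 0 < `|s - x| by rewrite normr_gt0 subr_eq0.
  rewrite -(ler_pM2r sx0) -normrM mulrBl divfK ?subr_eq0// [l * _]mulrC.
  apply: le_trans (fK s sd) _; rewrite -mulrA -expr2 real_normK ?num_real//.
  by rewrite ler_wpM2r ?sqr_ge0// ler_norm.
apply/cvgrPdist_le => e e0; rewrite /g eqxx -/g.
pose d' := Num.min d (e / (`|K| + 1)).
have K1 : 0 < `|K| + 1 by rewrite ltr_wpDl.
have d'0 : 0 < d' by rewrite lt_min d0 divr_gt0.
near=> s.
have sd' : `|s - x| < d'.
  by rewrite distrC; near: s; apply/nbhs_ballP; exists d'.
move: sd'; rewrite lt_min => /andP[sd se].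
rewrite distrC; apply: le_trans (gK s sd) _.
apply: (@le_trans _ _ ((`|K| + 1) * `|s - x|)); first by rewrite ler_wpM2r// lerDl.
by rewrite mulrC -ler_pdivlMr// ltW.
Unshelve. all: by end_near. Qed.

Lemma is_derive0_eq (f : R -> R) (a b : R) : a < b ->
  (forall s, a <= s -> is_derive s 1 f 0) -> f b = f a.
Proof.
move=> ab df.
have [c _ H] : exists2 c, c \in `]a, b[%R & f b - f a = 0 * (b - a).
  apply: (@MVT R f (fun=> 0)) => // [s|].
    by rewrite in_itv/= => /andP[/ltW sa _]; exact: df.
  apply: derivable_within_continuous => s; rewrite in_itv/= => /andP[/df ? _].
  exact: ex_derive.
by apply/eqP; rewrite -subr_eq0 H mul0r.
Qed.

End RealCalculus.

(** * The complex exponential near 0 *)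

Section ComplexExponential.
Variable R : realType.
Implicit Types (x y : R) (z w d : R[i]).

Lemma cexpD z w : cexp (z + w) = cexp z * cexp w.
Proof.
case: z => a b; case: w => u v; rewrite /cexp /= expRD cosD sinD.
by apply/eqP; rewrite eq_complex /=; apply/andP; split; apply/eqP; ring.
Qed.

Lemma cexp0 : cexp 0 = 1 :> R[i].
Proof. by rewrite /cexp /= expR0 cos0 sin0 !mul1r. Qed.

Lemma cexp_neq0 z : cexp z != 0.
Proof.
apply/eqP => z0; have := cexpD z (- z); rewrite subrr z0 mul0r cexp0.
by apply/eqP; exact: oner_neq0.
Qed.

Lemma MVT_bound (f df : R -> R) y (M : R) :
  (forall t : R, is_derive t 1 f (df t)) -> (forall t : R, `|t| <= `|y| -> `|df t| <= M) ->
  `|f y - f 0| <= M * `|y|.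
Proof.
move=> fdf dfM.
have cf (a b : R) : {within `[a, b], continuous f}.
  apply: derivable_within_continuous => t _; have ? := fdf t; exact: ex_derive.
have [y0|y0|->] := ltgtP y 0; last by rewrite subrr normr0 mulr0.
- have [c /[!in_itv]/= /andP[c1 c2] H] : exists2 c, c \in `]y, 0[%R &
      f 0 - f y = df c * (0 - y) by exact: MVT.
  rewrite distrC H normrM sub0r normrN ler_wpM2r// dfM//.
  by rewrite !ltr0_norm// lerN2 ltW.
- have [c /[!in_itv]/= /andP[c1 c2] H] : exists2 c, c \in `]0, y[%R &
      f y - f 0 = df c * (y - 0) by exact: MVT.
  rewrite H normrM subr0 ler_wpM2r// dfM//.
  by rewrite !gtr0_norm// ltW.
Qed.

Lemma normr_sin_le y : `|sin y| <= `|y|.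
Proof.
have := @MVT_bound sin cos y 1; rewrite sin0 subr0 mul1r; apply=> // t _.
by rewrite ler_norml cos_geN1 cos_le1.
Qed.

Lemma normr_cosB1_le y : `|cos y - 1| <= y ^+ 2.
Proof.
have := @MVT_bound cos (fun t => - sin t) y `|y|; rewrite cos0.
rewrite -expr2 real_normK ?num_real//; apply=> // t ty.
by rewrite normrN (le_trans (normr_sin_le t)).
Qed.

Lemma normr_sinB_le y : `|y| <= 1 -> `|sin y - y| <= y ^+ 2.
Proof.
move=> y1; have := @MVT_bound (fun t => sin t - t) (fun t => cos t - 1) y (y ^+ 2).
rewrite sin0 !subr0 => H; apply: le_trans (H _ _) _.
- move=> t ty; apply: le_trans (normr_cosB1_le t) _.
  by rewrite -[t ^+ 2]real_normK ?num_real// -[leRHS]real_normK ?num_real// lerXn2r ?nnegrE.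
- by rewrite ler_piMr// sqr_ge0.
Qed.

Lemma expR_quadratic x : `|x| <= 2^-1 -> 0 <= expR x - 1 - x <= 2 * x ^+ 2.
Proof.
rewrite ler_norml => /andP[x1 x2]; have e1 := expR_ge1Dx x.
apply/andP; split; first by lra.
have x10 : 0 < 1 - x by lra.
have e2 : expR x * (1 - x) <= 1.
  have := expR_ge1Dx (- x); rewrite expRN => h.
  by rewrite -ler_pdivlMl ?expR_gt0// mulr1.
rewrite -(ler_pM2r x10); apply: (@le_trans _ _ (x ^+ 2)).
  rewrite (_ : _ * (1 - x) = expR x * (1 - x) - 1 + x ^+ 2); last by ring.
  by lra.
have xx := sqr_ge0 x; nra.
Qed.

(** Estimated on the product exp(x) (cos y + i sin y): each factor is known up to
    a quadratic error. The constants are not sharp. *)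
Lemma cexp_quadratic d : normc d <= 2^-1 ->
  normc (cexp d - 1 - d) <= 5 * normc d ^+ 2.
Proof.
have := le_Re_normc d; have := le_Im_normc d.
case: d => x y; rewrite [complex.Re _]/= [complex.Im _]/= => hy hx nd.
have nd2 : normc (x +i* y) ^+ 2 = x ^+ 2 + y ^+ 2.
  by rewrite /= sqr_sqrtr// addr_ge0 ?sqr_ge0.
rewrite nd2; have x2 : `|x| <= 2^-1 by lra.
have /andP[e0 e1] := expR_quadratic x2.
have y1 : `|y| <= 1 by lra.
have hS := normr_sinB_le y1; have hC := normr_cosB1_le y.
apply: le_trans (normc_le_ReIm _) _; rewrite /cexp /= !subr0.
move: (expR x) (cos y) (sin y) hS hC e0 e1 => E C S hS hC e0 e1.
have xx : x ^+ 2 = `|x| ^+ 2 by rewrite real_normK ?num_real.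
have yy : y ^+ 2 = `|y| ^+ 2 by rewrite real_normK ?num_real.
have x0 := normr_ge0 x; have y0 := normr_ge0 y.
have xx2 : x ^+ 2 <= 2^-1 * `|x| by rewrite xx expr2 ler_wpM2r.
have /andP[xl xu] : - `|x| <= x <= `|x| by rewrite -ler_norml.
have E2 : `|E| <= 2 by rewrite ler_norml; apply/andP; split; lra.
have E1 : `|E - 1| <= 2 * `|x| by rewrite ler_norml; apply/andP; split; lra.
have h1 : `|E * C - 1 - x| <= 2 * x ^+ 2 + 2 * y ^+ 2.
  rewrite (_ : _ - x = (E - 1 - x) + E * (C - 1)); last by ring.
  apply: le_trans (ler_normD _ _) _; apply: lerD; first by rewrite ger0_norm.
  by rewrite normrM ler_pM.
have h2 : `|E * S - y| <= 2 * y ^+ 2 + 2 * `|x| * `|y|.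
  rewrite (_ : _ - y = E * (S - y) + (E - 1) * y); last by ring.
  apply: le_trans (ler_normD _ _) _; apply: lerD.
    by rewrite normrM ler_pM.
  by rewrite normrM ler_wpM2r.
have h3 : 2 * `|x| * `|y| <= x ^+ 2 + y ^+ 2.
  rewrite xx yy -subr_ge0 (_ : _ - _ = (`|x| - `|y|) ^+ 2) ?sqr_ge0//; ring.
lra.
Qed.

Lemma vanishing_cexpB1 (d : nat -> R[i]) : vanishing d ->
  vanishing (fun n => cexp (d n) - 1).
Proof.
move=> d0; rewrite /vanishing.
apply: (@squeeze_cvgr _ _ _ _ (fun=> 0) (fun n => 6 * normc (d n))).
- have h2 : 0 < 2^-1 :> R by rewrite invr_gt0.
  have := (@cvgrPdist_le _ _ _ _ _ (fun n => normc (d n)) 0).1 d0 _ h2.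
  move=> /(_ _); apply: filterS => n; rewrite sub0r normrN (ger0_norm (normc_ge0 _)) => dn.
  apply/andP; split; first exact: normc_ge0.
  rewrite (_ : cexp (d n) - 1 = (cexp (d n) - 1 - d n) + d n); last by rewrite subrK.
  apply: le_trans (le_normcD _ _) _.
  have := cexp_quadratic dn; have := normc_ge0 (d n); move: (normc _) dn => x xd x0 h.
  apply: (@le_trans _ _ (5 * x ^+ 2 + x)); first by rewrite lerD2r.
  nra.
- exact: cvg_cst.
- by rewrite -[X in _ --> X](mulr0 6); exact: cvgMr.
Qed.

End ComplexExponential.

(** * The differential equation along a ray *)

Section RayEquation.
Variables (R : realType) (B : R) (L : (R -> R) -> R).
Hypothesis hL : moment_functional B (@lambert_moment R) L.
Hypothesis B0 : 0 <= B.
Local Notation E := (cfunct L).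

Lemma slit_plane_inv_bounded (z : R[i]) n : slit_plane 0 z ->
  cbounded_upto B (fun t => (1 + t%:C * z) ^- n).
Proof.
move=> /slit_plane_normc_ge[c c0 cP]; exists (c^-1 ^+ n) => t /andP[t0 _].
have ct := cP t t0.
rewrite normcV normcX -exprVn lerXn2r ?nnegrE ?invr_ge0 ?normc_ge0 ?(ltW c0)//.
by rewrite lef_pV2 ?posrE// (lt_le_trans c0).
Qed.

(** With F(z) = z E((1+tz)^-1) and F'(z) = E((1+tz)^-2), this reads
    z F' (1 + F) = F. It is [resolvent_equation] after the powers of alpha
    have been divided out. *)
Lemma stieltjes_equation (z : R[i]) : slit_plane 0 z ->
  E (fun t => (1 + t%:C * z) ^- 2) * (1 + z * E (fun t => (1 + t%:C * z)^-1))
  = E (fun t => (1 + t%:C * z)^-1).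
Proof.
move=> zP; have [alpha [q q01 yq]] := slit_plane_contraction zP B0.
have a0 : alpha != 0.
  apply: contraTneq (yq 0 _) => [->|]; last by rewrite lexx.
  by rewrite mul0r subr0 normc1 -ltNge; case/andP: q01.
have b1 := slit_plane_inv_bounded 1 zP; have b2 := slit_plane_inv_bounded 2 zP.
have := resolvent_equation hL B0 q01 yq.
have -> : E (fun t => (1 - (1 - alpha * (1 + t%:C * z)))^-1) =
    alpha^-1 * E (fun t => (1 + t%:C * z)^-1).
  rewrite -(cfunctZ hL)//; congr cfunct; apply/funext => t.
  by rewrite subKr invfM.
have -> : E (fun t => (1 - (1 - alpha * (1 + t%:C * z))) ^- 2) =
    alpha ^- 2 * E (fun t => (1 + t%:C * z) ^- 2).
  rewrite -(cfunctZ hL)//; congr cfunct; apply/funext => t.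
  by rewrite subKr -exprVn invfM exprMn !exprVn.
move: (E _) (E _) => G D.
move/(congr1 (fun x => alpha * x)).
rewrite (_ : alpha * (_ - _) = D - G); last by field.
rewrite (_ : alpha * _ = - (z * D * G)); last by field.
by move/eqP; rewrite subr_eq => /eqP DE; rewrite mulrDr mulr1 {1}DE; ring.
Qed.

Variable z : R[i].
Hypothesis zP : slit_plane 0 z.

(** F(s z) for F(z) = z E((1+tz)^-1). On a ray the complex differential
    equation becomes a real one in the parameter s, and only real calculus is
    used. *)
Definition ray_transform (s : R) : R[i] :=
  s%:C * z * E (fun t => (1 + t%:C * (s%:C * z))^-1).

Local Notation P := ray_transform.
Local Notation D s := (E (fun t => (1 + t%:C * (s%:C * z)) ^- 2)).

Lemma slit_plane_ray (s : R) : 0 < s -> slit_plane 0 (s%:C * z).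
Proof.
move=> s0; move: zP; rewrite /slit_plane /=; case: z => x y /=.
rewrite !mul0r subr0 addr0 => h [sy sx].
apply: h; split; last by rewrite -(pmulr_rle0 _ s0).
by apply/eqP; move/eqP: sy; rewrite mulf_eq0 (gt_eqF s0).
Qed.

Lemma ray_normc_ge : exists2 c : R, 0 < c &
  forall s t : R, 0 <= s -> 0 <= t -> c <= normc (1 + t%:C * (s%:C * z)).
Proof.
(* t (s z) = (t s) z, so the bound for z serves the whole ray. *)
have [c c0 cP] := slit_plane_normc_ge zP; exists c => // s t s0 t0.
by rewrite mulrA -rmorphM; apply: cP; rewrite mulr_ge0.
Qed.

Lemma ray_inv_bounded (s : R) n : 0 <= s ->
  cbounded_upto B (fun t => (1 + t%:C * (s%:C * z)) ^- n).
Proof.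
move=> s0; have [c c0 cP] := ray_normc_ge; exists (c^-1 ^+ n) => t /andP[t0 _].
have ct := cP s t s0 t0.
rewrite normcV normcX -exprVn lerXn2r ?nnegrE ?invr_ge0 ?normc_ge0 ?(ltW c0)//.
by rewrite lef_pV2 ?posrE// (lt_le_trans c0).
Qed.

Lemma ray_neq0 (s t : R) : 0 <= s -> 0 <= t -> 1 + t%:C * (s%:C * z) != 0.
Proof.
have [c c0 cP] := ray_normc_ge => s0 t0; apply: contraTneq (cP s t s0 t0) => ->.
by rewrite normc0 -ltNge.
Qed.

(** The remainder is exactly the functional applied to
    - (z (s-s0))^2 t (1+tsz)^-1 (1+ts0z)^-2, and the factors 1 + tsz are bounded
    away from 0 uniformly in s and t. *)
Lemma ray_transform_taylor : exists K : R, forall s s0 : R, 0 <= s -> 0 <= s0 ->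
  normc (P s - P s0 - (s - s0)%:C * (z * D s0)) <= K * (s - s0) ^+ 2.
Proof.
have [c c0 cP] := ray_normc_ge.
exists (2 * (normc z ^+ 2 * (B * (c^-1 * c^-1 ^+ 2)))) => s r s0 r0.
have bs := ray_inv_bounded 1 s0; have br := ray_inv_bounded 1 r0.
have br2 := ray_inv_bounded 2 r0.
have b0 : cbounded_upto B (fun=> 0) by exact: cbounded_upto_cst.
have -> : P s - P r - (s - r)%:C * (z * D r) =
    E (fun t => - (z * (s - r)%:C) ^+ 2 * (t%:C *
      ((1 + t%:C * (s%:C * z))^-1 * (1 + t%:C * (r%:C * z)) ^- 2))).
  rewrite /ray_transform; transitivity (s%:C * z * E (fun t => (1 + t%:C * (s%:C * z))^-1) +
      ((- (r%:C * z)) * E (fun t => (1 + t%:C * (r%:C * z))^-1) +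
       (- ((s - r)%:C * z)) * D r)); first by ring.
  rewrite -[X in _ + (_ + X)](cfunctZ hL)// -[X in _ + X](cfunct_linear hL)//; last first.
    exact: (cbounded_uptoM (cbounded_upto_cst _ _) br2).
  have b3 : cbounded_upto B (fun t => - (r%:C * z) * (1 + t%:C * (r%:C * z))^-1 +
      - ((s - r)%:C * z) * (1 + t%:C * (r%:C * z)) ^- 2).
    by apply: cbounded_uptoZD => //; exact: (cbounded_uptoM (cbounded_upto_cst _ _) br2).
  rewrite -(cfunct_linear hL) //; apply: (cfunct_ext hL).
    exact: cbounded_uptoZD.
  move=> t /andP[t0 _]; have as0 := ray_neq0 s0 t0; have ar0 := ray_neq0 r0 t0.
  rewrite rmorphB/=; move: as0 ar0.
  by move: (t%:C : R[i]) (s%:C : R[i]) (r%:C : R[i]) => T S Q as0 ar0; field; rewrite as0 ar0.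
rewrite -!mulrA; apply: (cfunct_normc_le hL) => t tB.
have /andP[t0 tB'] := tB.
have inv_le u : 0 <= u -> normc (1 + t%:C * (u%:C * z))^-1 <= c^-1.
  by move=> u0; rewrite normcV lef_pV2 ?posrE ?cP// (lt_le_trans c0)// cP.
have cV0 : 0 <= c^-1 by rewrite invr_ge0 ltW.
rewrite normcM normcN normcX normcM exprMn normc_real real_normK ?num_real//.
rewrite [leRHS](_ : _ = normc z ^+ 2 * (s - r) ^+ 2 * (B * (c^-1 * c^-1 ^+ 2))); last by ring.
apply: ler_wpM2l; first by rewrite mulr_ge0 ?sqr_ge0.
rewrite normcM normc_real ger0_norm// ler_pM ?normc_ge0//.
rewrite normcM ler_pM ?normc_ge0 ?inv_le//.
by rewrite -exprVn normcX lerXn2r ?nnegrE ?normc_ge0 ?inv_le.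
Qed.

Lemma ray_transform_lipschitz : exists K : R, forall s r : R,
  0 <= s <= 1 -> 0 <= r <= 1 -> normc (P s - P r) <= K * `|s - r|.
Proof.
have [c c0 cP] := ray_normc_ge.
have cV0 : 0 <= c^-1 by rewrite invr_ge0 ltW.
have [K KP] := ray_transform_taylor.
have KK s r : K * (s - r) ^+ 2 <= `|K| * (s - r) ^+ 2.
  by rewrite ler_wpM2r ?sqr_ge0// ler_norm.
exists (`|K| + normc z * (2 * c^-1 ^+ 2)) => s r /andP[s0 s1] /andP[r0 r1].
have -> : P s - P r = (P s - P r - (s - r)%:C * (z * D r)) + (s - r)%:C * (z * D r).
  by rewrite subrK.
apply: le_trans (le_normcD _ _) _; rewrite mulrDl; apply: lerD.
  apply: le_trans (KP s r s0 r0) _; apply: le_trans (KK s r) _.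
  rewrite ler_wpM2l// -real_normK ?num_real// expr2 ler_piMl//.
  by rewrite ler_norml; apply/andP; split; lra.
rewrite normcM normc_real mulrC ler_wpM2r// normcM ler_wpM2l ?normc_ge0//.
apply: (cfunct_normc_le hL) => t /andP[t0 _].
rewrite -exprVn normcX lerXn2r ?nnegrE ?normc_ge0// normcV lef_pV2 ?posrE ?cP//.
by rewrite (lt_le_trans c0)// cP.
Qed.

(** At s = 0 the integrand is the constant 1, of value m_0 = 1. *)
Lemma ray_resolvent_cvg1 : exists K : R, forall s : R, 0 <= s ->
  normc (E (fun t => (1 + t%:C * (s%:C * z))^-1) - 1) <= K * s.
Proof.
have [c c0 cP] := ray_normc_ge.
exists (2 * (B * normc z * c^-1)) => s s0.
have bs := ray_inv_bounded 1 s0.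
have -> : E (fun t => (1 + t%:C * (s%:C * z))^-1) - 1 =
    E (fun t => - (t%:C * (s%:C * z)) * (1 + t%:C * (s%:C * z))^-1).
  have E1 : E (fun=> 1) = 1.
    by rewrite /cfunct (mfunct1 hL) (mfunct0 hL) lambert_moment0.
  rewrite -[X in _ - X]E1 addrC -mulN1r -(cfunct_linear hL)//; last exact: cbounded_upto_cst.
  apply: (cfunct_ext hL) => [|t /andP[t0 _]].
    by apply: cbounded_uptoZD => //; exact: cbounded_upto_cst.
  by have a0 := ray_neq0 s0 t0; field.
rewrite -mulrA; apply: (cfunct_normc_le hL) => t /andP[t0 tB].
have cs := cP s t s0 t0.
rewrite normcM normcN !normcM !normc_real !ger0_norm//.
rewrite (_ : B * _ * _ * _ = B * (s * normc z) * c^-1); last by ring.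
rewrite ler_pM ?mulr_ge0 ?normc_ge0//.
  by rewrite ler_wpM2r ?mulr_ge0 ?normc_ge0.
by rewrite normcV lef_pV2 ?posrE// (lt_le_trans c0).
Qed.

Lemma ray_transform_derive (s : R) : 0 < s ->
  is_derive s 1 (fun s => complex.Re (P s)) (complex.Re (z * D s)) /\
  is_derive s 1 (fun s => complex.Im (P s)) (complex.Im (z * D s)).
Proof.
move=> s0; have [K KP] := ray_transform_taylor.
have rK r : `|r - s| < s ->
    normc (P r - P s - (r - s)%:C * (z * D s)) <= K * (r - s) ^+ 2.
  by rewrite ltr_norml => /andP[rs _]; apply: KP; lra.
split; apply: (@is_derive_of_taylor _ _ _ _ K s) => // r /rK; apply: le_trans.
  apply: le_trans (le_Re_normc _); rewrite le_eqVlt; apply/orP; left; apply/eqP.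
  case: (P r) => a b; case: (P s) => a' b'; case: (z * D s) => u v /=.
  by congr `|_|; ring.
apply: le_trans (le_Im_normc _); rewrite le_eqVlt; apply/orP; left; apply/eqP.
case: (P r) => a b; case: (P s) => a' b'; case: (z * D s) => u v /=.
by congr `|_|; ring.
Qed.

(** The equation s P' (1 + P) = P split into real and imaginary parts. *)
Lemma ray_transform_ode (s : R) : 0 < s ->
  let X := complex.Re (P s) in let Y := complex.Im (P s) in
  let X' := complex.Re (z * D s) in let Y' := complex.Im (z * D s) in
  X' * (1 + X) - Y' * Y = X * s^-1 /\ X' * Y + Y' * (1 + X) = Y * s^-1.
Proof.
move=> s0 /=; have sn0 : s != 0 by rewrite gt_eqF.
have : s%:C * ((z * D s) * (1 + P s)) = P s.
  have H := stieltjes_equation (slit_plane_ray s0); rewrite -/(P s) in H.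
  transitivity (s%:C * z * (D s * (1 + P s))); first by ring.
  by rewrite H.
case: (z * D s) => u v; case: (P s) => a b /=.
move=> /eqP; rewrite eq_complex => /andP[/eqP /= h1 /eqP /= h2].
split; apply: (mulfI sn0); rewrite mulrCA mulfV// mulr1.
  by rewrite -[RHS]h1; ring.
by rewrite -[RHS]h2; ring.
Qed.

(** From s P' (1 + P) = P one gets (P exp(P)/s)' = 0. The constant is the limit
    at s = 0, where P(s)/s tends to z and exp(P(s)) to 1. *)
Theorem ray_transform_lambert : P 1 * cexp (P 1) = z.
Proof.
pose X s := complex.Re (P s); pose Y s := complex.Im (P s).
(* f1 and f2 are the real and imaginary parts of P exp(P)/s. *)
pose f1 s := expR (X s) * (X s * cos (Y s) - Y s * sin (Y s)) * s^-1.
pose f2 s := expR (X s) * (X s * sin (Y s) + Y s * cos (Y s)) * s^-1.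
have df (s : R) : 0 < s -> is_derive s 1 f1 0 /\ is_derive s 1 f2 0.
  move=> s0; have [dX dY] := ray_transform_derive s0.
  have /= [] := ray_transform_ode s0; rewrite -/(X s) -/(Y s).
  move: dX dY; rewrite -/X -/Y.
  move: (complex.Re (z * _)) (complex.Im (z * _)) => X' Y' dX dY odeX odeY.
  have sn0 : s != 0 by rewrite gt_eqF.
  have dE : is_derive s 1 (expR \o X) (expR (X s) * X') by exact: is_derive1_comp.
  have dC : is_derive s 1 (cos \o Y) (- sin (Y s) * Y') by exact: is_derive1_comp.
  have dS : is_derive s 1 (sin \o Y) (cos (Y s) * Y') by exact: is_derive1_comp.
  have dV : is_derive s 1 (fun s : R => s^-1) (- s ^- 2).
    by have := is_deriveV (f := id) sn0 (is_derive_id s 1); rewrite /GRing.scale/= mulr1.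
  split.
    rewrite (_ : f1 = ((expR \o X) * (X * (cos \o Y) - Y * (sin \o Y))) * (fun s => s^-1)); last by [].
    apply: (is_derive_eq (is_deriveM (is_deriveM dE
      (is_deriveB (is_deriveM dX dC) (is_deriveM dY dS))) dV)); rewrite /GRing.scale/=.
    transitivity (expR (X s) * s^-1 * (cos (Y s) * (X' * (1 + X s) - Y' * Y s - X s * s^-1)
        - sin (Y s) * (X' * Y s + Y' * (1 + X s) - Y s * s^-1))).
      rewrite !fctE /=.
      move: (expR (X s)) (cos (Y s)) (sin (Y s)) (X s) (Y s) => e c v a b.
      by field.
    by rewrite odeX odeY !subrr !mulr0 subrr mulr0.
  rewrite (_ : f2 = ((expR \o X) * (X * (sin \o Y) + Y * (cos \o Y))) * (fun s => s^-1)); last by [].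
  apply: (is_derive_eq (is_deriveM (is_deriveM dE
      (is_deriveD (is_deriveM dX dS) (is_deriveM dY dC))) dV)); rewrite /GRing.scale/=.
  transitivity (expR (X s) * s^-1 * (sin (Y s) * (X' * (1 + X s) - Y' * Y s - X s * s^-1)
      + cos (Y s) * (X' * Y s + Y' * (1 + X s) - Y s * s^-1))).
    rewrite !fctE /=.
    move: (expR (X s)) (cos (Y s)) (sin (Y s)) (X s) (Y s) => e c v a b.
    by field.
  by rewrite odeX odeY !subrr !mulr0 addr0 mulr0.
have P1 : P 1 * cexp (P 1) = f1 1 +i* f2 1.
  rewrite /f1 /f2 /X /Y invr1 !mulr1 /cexp; case: (P 1) => a b /=.
  by congr (_ +i* _); ring.
pose s n : R := n.+2%:R^-1.
have s0 n : 0 < s n by rewrite invr_gt0 ltr0n.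
have s1 n : s n < 1 by rewrite invf_lt1 ?ltr0n// ltr1n.
have scvg : s n @[n --> \oo] --> (0 : R).
  by rewrite (cvg_shiftS (fun n => n.+1%:R^-1 : R)); exact: cvg_harmonic.
pose g n := E (fun t => (1 + t%:C * ((s n)%:C * z))^-1).
have Pn n : P 1 * cexp (P 1) = z * (g n * cexp (P (s n))).
  have sn := s0 n.
  have -> : P 1 * cexp (P 1) = f1 (s n) +i* f2 (s n).
    rewrite P1; congr (_ +i* _); apply: is_derive0_eq => // r sr.
      by have [] := df r (lt_le_trans sn sr).
    by have [] := df r (lt_le_trans sn sr).
  have -> : f1 (s n) +i* f2 (s n) = P (s n) * cexp (P (s n)) * (s n)^-1%:C.
    rewrite /f1 /f2 /X /Y /cexp; case: (P (s n)) => a b /=.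
    by congr (_ +i* _); ring.
  have -> : ((s n)^-1)%:C = (s n)%:C^-1 :> R[i] by exact: fmorphV.
  rewrite /ray_transform -/(g n).
  have snC : (s n)%:C != 0 :> R[i] by rewrite fmorph_eq0 gt_eqF.
  by move: ((s n)%:C : R[i]) (g n) (cexp _) snC => S G C snC; field.
apply/eqP; rewrite -subr_eq0; apply/eqP/vanishing_cst.
have [K gK] := ray_resolvent_cvg1; have [K' PK] := ray_transform_lipschitz.
have vg : vanishing (fun n => g n - 1).
  apply: (vanishing_le (b := fun n => K * s n)) => [n|]; first exact/gK/ltW.
  by rewrite -[X in _ --> X](mulr0 K); exact: cvgMr.
have P0 : P 0 = 0 by rewrite /ray_transform !mul0r.
have vP : vanishing (fun n => P (s n)).
  apply: (vanishing_le (b := fun n => K' * s n)) => [n|].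
    have s01 : 0 <= s n <= 1 by rewrite (ltW (s0 n)) (ltW (s1 n)).
    have z01 : 0 <= (0 : R) <= 1 by rewrite lexx ler01.
    by have := PK _ _ s01 z01; rewrite P0 !subr0 (ger0_norm (ltW (s0 n))).
  by rewrite -[X in _ --> X](mulr0 K'); exact: cvgMr.
have vE := vanishing_cexpB1 vP.
have h : vanishing (fun n => z * ((g n - 1) + ((g n - 1) * (cexp (P (s n)) - 1)
    + (cexp (P (s n)) - 1)))).
  apply/vanishingZ/vanishingD => //; apply: vanishingD => //.
  exact: vanishingM.
move: h; congr vanishing; apply/funext => n; rewrite (Pn n); ring.
Qed.

End RayEquation.

(** * Uniqueness of branches of w exp(w) *)

Section LambertUniqueness.
Variable R : realType.
Implicit Types (p q : R -> R[i]) (W : R[i] -> R[i]).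

Definition path_continuous p : Prop := forall s0 e : R,
  0 <= s0 <= 1 -> 0 < e -> exists2 d : R, 0 < d &
  forall s : R, 0 <= s <= 1 -> `|s - s0| < d -> normc (p s - p s0) < e.

Lemma path_continuous_lipschitz p (K : R) :
  (forall s r : R, 0 <= s <= 1 -> 0 <= r <= 1 ->
    normc (p s - p r) <= K * `|s - r|) -> path_continuous p.
Proof.
move=> pK s0 e s01 e0; have K0 : 0 < `|K| + 1 by rewrite ltr_wpDl.
exists (e / (`|K| + 1)) => [|s ss]; first by rewrite divr_gt0.
rewrite ltr_pdivlMr// mulrC => h; apply: le_lt_trans (pK _ _ ss s01) _.
apply: le_lt_trans h; rewrite ler_wpM2r//.
by apply: le_trans (ler_norm K) _; rewrite lerDl.
Qed.

Lemma path_continuousD p q : path_continuous p -> path_continuous q ->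
  path_continuous (fun s => p s + q s).
Proof.
move=> cp cq s0 e s01 e0; have e2 : 0 < e / 2 by rewrite divr_gt0.
have [d1 d10 h1] := cp s0 _ s01 e2; have [d2 d20 h2] := cq s0 _ s01 e2.
exists (Num.min d1 d2) => [|s ss]; first by rewrite lt_min d10.
rewrite lt_min => /andP[s1 s2]; rewrite opprD addrACA (splitr e).
by apply: le_lt_trans (le_normcD _ _) _; apply: ltrD; [exact: h1|exact: h2].
Qed.

Lemma path_continuousN p : path_continuous p -> path_continuous (fun s => - p s).
Proof.
move=> cp s0 e s01 e0; have [d d0 h] := cp s0 e s01 e0; exists d => // s ss sd.
by rewrite -opprD normcN; exact: h.
Qed.

Lemma path_continuous_normc p : path_continuous p ->
  {within `[0, 1], continuous (fun s => normc (p s))}.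
Proof.
move=> cp; apply/subspace_continuousP => s0 /=; rewrite in_itv/= => s01.
apply/cvgrPdist_lt => e e0; have [d d0 h] := cp s0 e s01 e0.
apply/nbhs_ballP; exists d => //= s sd; rewrite in_itv/= => ss.
rewrite distrC; apply: le_lt_trans (h s ss _); last by rewrite distrC.
have h1 := normcB (p s) (p s - p s0); rewrite subKr in h1.
have h2 := le_normcD (p s - p s0) (p s0); rewrite subrK in h2.
suff H : `|normc (p s) - normc (p s0)| <= normc (p s - p s0) by exact: H.
by rewrite ler_norml; apply/andP; split; lra.
Qed.

(** Dividing the equation by exp(w) gives d (1 + w) = - (d^2 + r (w + d)) with
    r = exp(d) - 1 - d of order d^2. So two distinct solutions near each other
    force w to be near the critical point -1. *)
Lemma cexp_branch_separation (w d : R[i]) (eta Q : R) :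
  eta <= normc (1 + w) -> normc w <= Q -> d != 0 ->
  (w + d) * cexp (w + d) = w * cexp w -> normc d <= 2^-1 ->
  eta <= normc d * (4 + 5 * Q).
Proof.
move=> etaw wQ dn0 wd d2; apply: le_trans etaw _.
have dq := cexp_quadratic d2; set r := cexp d - 1 - d in dq.
have dE : d * (1 + w) = - (d ^+ 2 + r * (w + d)).
  have H : (w + d) * cexp d = w.
    apply: (mulIf (cexp_neq0 w)); rewrite -wd cexpD; ring.
  have rE : cexp d = 1 + d + r by rewrite /r; ring.
  move: H; rewrite rE => H; apply/eqP; rewrite -subr_eq0.
  have -> : d * (1 + w) - - (d ^+ 2 + r * (w + d)) = (w + d) * (1 + d + r) - w.
    by ring.
  by rewrite H subrr.
have nd0 : 0 < normc d.
  by rewrite lt_neqAle normc_ge0 andbT eq_sym; apply: contra_neq dn0; exact: normc_eq0P.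
rewrite -(ler_pM2l nd0) -normcM dE normcN.
apply: le_trans (le_normcD _ _) _; rewrite normcX normcM.
have := le_normcD w d; have := normc_ge0 w; have := normc_ge0 (w + d).
have := normc_ge0 r.
move: (normc r) (normc w) (normc d) (normc (w + d)) dq d2 nd0 wQ => nr nw nd nwd dq d2 nd0 wQ r0 wd0 w0 wdle.
have h : nr * nwd <= 5 * nd ^+ 2 * (Q + 2^-1) by rewrite ler_pM//; lra.
apply: (@le_trans _ _ (nd ^+ 2 + 5 * nd ^+ 2 * (Q + 2^-1))); first by rewrite lerD2l.
have := sqr_ge0 nd; nra.
Qed.

(** On the compact interval 1 + q is bounded away from 0, so p and q are equal
    or at least rho apart. By the intermediate value theorem |p - q|, which
    starts at 0, would have to take the value rho/2. *)
Theorem cexp_branch_unique p q : path_continuous p -> path_continuous q ->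
  p 0 = q 0 ->
  (forall s, 0 <= s <= 1 -> p s * cexp (p s) = q s * cexp (q s)) ->
  (forall s, 0 <= s <= 1 -> 1 + q s != 0) ->
  p 1 = q 1.
Proof.
move=> cp cq pq0 pq q1.
have c1 : path_continuous (fun=> 1 : R[i]).
  by apply: (@path_continuous_lipschitz _ 0) => s r _ _; rewrite subrr normc0 mul0r.
have cphi := path_continuous_normc (path_continuousD cp (path_continuousN cq)).
have c1q := path_continuous_normc (path_continuousD c1 cq).
have [s0 s0I etamin] := EVT_min ler01 c1q.
have [s1 s1I Qmax] := EVT_max ler01 (path_continuous_normc cq).
set eta := normc _ in etamin; set Q := normc _ in Qmax.
(* Distance to the critical point -1, positive by compactness. *)
have eta0 : 0 < eta.
  rewrite lt_neqAle normc_ge0 andbT eq_sym; apply/eqP => /normc_eq0P /eqP.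
  by apply/negP; apply: q1; move: s0I; rewrite in_itv.
have Q0 : 0 <= Q by exact: normc_ge0.
(* The gap that the separation of branches leaves, within the range 1/2 where
   the exponential is controlled. *)
pose rho := Num.min 2^-1 (eta / (4 + 5 * Q)).
have K0 : 0 < 4 + 5 * Q by lra.
have rho0 : 0 < rho by rewrite lt_min invr_gt0 ltr0n/= divr_gt0.
have gap s : 0 <= s <= 1 -> p s != q s -> rho <= normc (p s - q s).
  move=> s01 pqs; rewrite leNgt lt_min; apply/negP => /andP[d2].
  rewrite ltr_pdivlMr// ltNge => /negP; apply.
  have sI : s \in `[0, 1]%R by rewrite in_itv.
  apply: (@cexp_branch_separation (q s)); rewrite ?subr_eq0 ?(ltW d2)//.
  - exact: etamin.
  - exact: Qmax.
  - by rewrite addrC subrK pq.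
apply/eqP; apply: contraT => p1.
have h1 : rho <= normc (p 1 - q 1) by apply: gap => //; rewrite ler01 lexx.
have [c] : exists2 c, c \in `[0, 1]%R & normc (p c - q c) = rho / 2.
  apply: (IVT ler01 cphi); rewrite pq0 subrr normc0.
  rewrite min_l ?normc_ge0// max_r ?normc_ge0//.
  by apply/andP; split; lra.
rewrite in_itv/= => c01 cE; have [pc|pc] := eqVneq (p c) (q c).
  by move: cE; rewrite pc subrr normc0; lra.
by have := gap c c01 pc; rewrite cE; lra.
Qed.

Lemma derivable_normc_continuous W (z : R[i]) :
  derivable (W : R[i]^o -> R[i]^o) z 1 -> forall e : R, 0 < e ->
  exists2 d : R, 0 < d & forall w, normc (w - z) < d -> normc (W w - W z) < e.
Proof.
move=> /derivable1_diffP/differentiable_continuous cW e e0.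
move/cvgrPdist_lt : cW => /(_ e%:C); rewrite ltcR => /(_ e0) /nbhs_ballP[d /= d0 dW].
have [d1 dE] : exists d1 : R, d = d1%:C.
  by exists (complex.Re d); rewrite RRe_real// gtr0_real.
exists d1 => [|w wz]; first by move: d0; rewrite dE ltcR.
have : `|W z - W w| < e%:C.
  apply: dW; rewrite -ball_normE /ball_/= normr_normc dE ltcR.
  by rewrite -normcN opprB.
by rewrite normr_normc ltcR -normcN opprB.
Qed.

Lemma slit_plane_ray_closed (z : R[i]) (a s : R) : slit_plane 0 z -> a < 0 ->
  0 <= s -> slit_plane a (s%:C * z).
Proof.
rewrite /slit_plane /=; case: z => x y /= h a0 s0.
rewrite !mul0r subr0 addr0 => -[/eqP]; rewrite mulf_eq0 => /orP[/eqP->|/eqP y0].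
  by rewrite mul0r; lra.
have x0 : 0 < x by rewrite ltNge; apply/negP => x0; exact: h.
by have := mulr_ge0 s0 (ltW x0); lra.
Qed.

(** W(s z) and F(s z) both solve w exp(w) = s z and vanish at s = 0. The
    critical value w = -1 would give s z = -1/e, which the slit excludes. *)
Theorem principal_lambertW_ray W (L : (R -> R) -> R) (B : R) (z : R[i]) :
  moment_functional B (@lambert_moment R) L -> 0 <= B ->
  principal_lambertW W -> slit_plane 0 z -> W z = ray_transform L z 1.
Proof.
move=> hL B0 [holW eqW W0] zP.
have e0 : - (expR 1)^-1 < 0 :> R by rewrite oppr_lt0 invr_gt0 expR_gt0.
have P0 : ray_transform L z 0 = 0 by rewrite /ray_transform !mul0r.
have Peq (s : R) : 0 <= s ->
    ray_transform L z s * cexp (ray_transform L z s) = s%:C * z.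
  rewrite le_eqVlt => /predU1P[<-|s0]; first by rewrite P0 !mul0r.
  have := ray_transform_lambert hL B0 (slit_plane_ray zP s0).
  by rewrite /ray_transform !mul1r.
have [K PK] := ray_transform_lipschitz hL zP.
have -> : W z = W (1%:C * z) by rewrite rmorph1 mul1r.
apply: (@cexp_branch_unique (fun s => W (s%:C * z))).
- move=> s0 e /andP[s00 _] e1.
  have [d d0 dW] := derivable_normc_continuous (holW _ (slit_plane_ray_closed zP e0 s00)) e1.
  have nz1 : 0 < normc z + 1 by rewrite ltr_wpDl ?normc_ge0.
  exists (d / (normc z + 1)) => [|s _]; first by rewrite divr_gt0.
  rewrite ltr_pdivlMr// => sd; apply: dW.
  rewrite -mulrBl -rmorphB normcM normc_real; apply: le_lt_trans sd.
  by rewrite ler_wpM2l// lerDl.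
- exact: path_continuous_lipschitz PK.
- by rewrite P0 mul0r W0.
- move=> s /andP[s0 _]; rewrite Peq// eqW//.
  exact: slit_plane_ray_closed.
- move=> s /andP[s0 _]; apply/eqP => P1.
  have PE : ray_transform L z s = (-1)%:C by apply/eqP; rewrite -subr_eq0 rmorphN opprK addrC P1.
  have := slit_plane_ray_closed zP e0 s0; apply.
  rewrite -(Peq s s0) PE /cexp /= sin0 cos0 !mulr0 !mulr1 !mul0r subr0 addr0 mulN1r expRN.
  by split.
Qed.

End LambertUniqueness.

(** * The Stieltjes measure of a moment functional *)

Section DistributionFunction.
Variables (R : realType) (B : R) (m : nat -> R) (L : (R -> R) -> R).
Hypothesis hL : moment_functional B m L.
Hypothesis B0 : 0 <= B.
Implicit Types (x y u : R) (f : R -> R).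

Definition mass_below x : R := L (fun u => (u < x)%R%:R).
(** Without countable additivity the mass of a half-line need not be right
    continuous in its end point, so that the cumulative function at x is only
    known to lie between the closed masses at x and at any later point. *)
Definition mass_upto x : R := L (fun u => (u <= x)%R%:R).

Lemma bounded_indicator (P : R -> bool) : bounded_upto B (fun u => (P u)%:R).
Proof. by exists 1 => u _; rewrite ger0_norm//; case: (P u). Qed.

Lemma mfunct_indicator_le (P Q : R -> bool) :
  (forall u, 0 <= u <= B -> P u -> Q u) ->
  L (fun u => (P u)%:R) <= L (fun u => (Q u)%:R).
Proof.
move=> PQ; apply: (mfunct_le hL); [exact: bounded_indicator..|].
by move=> u uB; have := PQ u uB; case: (P u) => [->|]; rewrite ?ler0n.
Qed.

Lemma mfunct_indicator0 (P : R -> bool) :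
  (forall u, 0 <= u <= B -> ~~ P u) -> L (fun u => (P u)%:R) = 0.
Proof.
move=> P0; rewrite -(mfunct0 hL); apply: (mfunct_ext hL).
  exact: bounded_indicator.
by move=> u uB; rewrite (negbTE (P0 u uB)).
Qed.

Lemma mfunct_indicator1 (P : R -> bool) :
  (forall u, 0 <= u <= B -> P u) -> L (fun u => (P u)%:R) = m 0%N.
Proof.
move=> P1; rewrite -(mfunct1 hL); apply: (mfunct_ext hL).
  exact: bounded_indicator.
by move=> u uB; rewrite P1.
Qed.

Lemma nondecreasing_mass_below : nondecreasing_nonneg mass_below.
Proof.
move=> x y _ xy; apply: mfunct_indicator_le => u _ ux.
exact: lt_le_trans ux xy.
Qed.

Lemma mass_below_le0 x : x <= 0 -> mass_below x = 0.
Proof.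
move=> x0; apply: mfunct_indicator0 => u /andP[u0 _].
by rewrite -leNgt (le_trans x0).
Qed.

Lemma mass_below_ge0 x : 0 <= mass_below x.
Proof.
by apply: (mfunct_ge0 hL); [exact: bounded_indicator|move=> u _; rewrite ler0n].
Qed.

Lemma mass_below_le x : mass_below x <= m 0%N.
Proof.
rewrite -(mfunct1 hL).
exact: (@mfunct_indicator_le (fun u => u < x) (fun=> true)).
Qed.

Lemma mass_below_bounded : [bounded mass_below u | u in `[0, +oo[%classic].
Proof.
exists (m 0%N); split; first exact: num_real.
move=> M mM u _ /=; rewrite ger0_norm ?mass_below_ge0//.
exact: le_trans (mass_below_le u) (ltW mM).
Qed.

Variable ndPhi : nondecreasing_nonneg mass_below.
Local Notation Phi := (stieltjes_cumulative ndPhi).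
Local Notation mu := (stieltjes_measure ndPhi).
Local Notation D := (`[(0 : R), +oo[%classic).

Lemma stieltjes_cumulative_ge x (b : R) :
  (forall y, x < y -> b <= mass_below (Num.max y 0)) -> b <= Phi x.
Proof.
move=> bP; apply: lb_le_inf; first exact: (stieltjes_cumulative_has_inf ndPhi x).1.
by move=> _ [y /= + <-]; rewrite in_itv/= andbT; exact: bP.
Qed.

Lemma mass_upto_le_cumulative x : 0 <= x ->
  mass_upto x <= Phi x.
Proof.
move=> x0; apply: stieltjes_cumulative_ge => y xy.
rewrite max_l ?(le_trans x0 (ltW xy))//; apply: mfunct_indicator_le => u _ ux.
exact: le_lt_trans ux xy.
Qed.

Lemma cumulative_le_mass_upto x y : 0 <= x -> x < y ->
  Phi x <= mass_upto y.
Proof.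
move=> x0 xy; apply: le_trans (stieltjes_cumulative_le ndPhi xy) _.
rewrite max_l ?(le_trans x0 (ltW xy))//; apply: mfunct_indicator_le => u _.
exact: ltW.
Qed.

Lemma cumulative_lt0 x : x < 0 -> Phi x = 0.
Proof.
move=> x0; apply/eqP; rewrite eq_le; apply/andP; split; last first.
  by apply: stieltjes_cumulative_ge => y _; exact: mass_below_ge0.
apply: le_trans (stieltjes_cumulative_le ndPhi x0) _.
by rewrite maxxx mass_below_le0.
Qed.

Lemma cumulative_ge x : B <= x -> Phi x = m 0%N.
Proof.
move=> xB; apply/eqP; rewrite eq_le; apply/andP; split.
  have x1 : x < x + 1 by rewrite ltrDl.
  exact: le_trans (stieltjes_cumulative_le ndPhi x1) (mass_below_le _).
have x0 : 0 <= x by exact: le_trans B0 xB.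
apply: le_trans (mass_upto_le_cumulative x0).
rewrite le_eqVlt; apply/orP; left; apply/eqP/esym/mfunct_indicator1 => u.
by move=> /andP[_ uB]; exact: le_trans uB xB.
Qed.

Lemma stieltjes_measure_itv x y : x <= y ->
  mu `]x, y]%classic = (Phi y - Phi x)%:E.
Proof.
move=> xy; rewrite /stieltjes_measure /lebesgue_stieltjes_measure.
rewrite /measure_extension/= measurable_mu_extE/=; last exact: is_ocitv.
by rewrite wlength_itv_bnd.
Qed.

Lemma stieltjes_measure_tail x : mu `]x, +oo[%classic = (m 0%N - Phi x)%:E.
Proof.
have mcvg : mu (`]x, x + (B + `|x| + n%:R)]%classic) @[n --> \oo] -->
    mu (\bigcup_(n : nat) `]x, x + (B + `|x| + n%:R)]%classic).
  apply: nondecreasing_cvg_mu => //; first exact: bigcup_measurable.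
  move=> i j ij; apply/subsetPset/subset_itvl.
  by rewrite bnd_simp !lerD2l ler_nat.
have U : \bigcup_(n : nat) `]x, x + (B + `|x| + n%:R)]%classic = `]x, +oo[%classic.
  apply/seteqP; split => [u [n _]|u] /=; rewrite !in_itv/=.
    by move=> /andP[->].
  rewrite andbT => xu; exists (Num.truncn `|u - x|).+1 => //=.
  rewrite in_itv/= xu/= -lerBlDl.
  apply: le_trans (ler_norm _) _; apply: le_trans (ltW (truncnS_gt _)) _.
  by rewrite lerDr addr_ge0.
rewrite -U; apply/esym; apply: cvg_unique mcvg => //.
rewrite (_ : (fun n => _) = (fun=> (m 0%N - Phi x)%:E)); first exact: cvg_cst.
apply/funext => n; rewrite stieltjes_measure_itv.
  rewrite cumulative_ge//.
  have h := ler_norm (- x); rewrite normrN in h.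
  by have n0 : 0 <= n%:R :> R; [by []|lra].
by rewrite lerDl !addr_ge0.
Qed.

(** The extension of Phi by a constant puts the jump at 0, if any, into the
    measure of {0}, so the total mass is found from intervals that start
    below 0. *)
Lemma stieltjes_measure_nonneg : mu D = (m 0%N)%:E.
Proof.
have mcvg : mu (`]- n.+1%:R^-1, +oo[%classic) @[n --> \oo] -->
    mu (\bigcap_(n : nat) `](- n.+1%:R^-1 : R), +oo[%classic).
  apply: nonincreasing_cvg_mu => //.
  - apply: (@le_lt_trans _ _ (m 0%N - Phi (- 1%:R^-1))%:E); last exact: ltry.
    by rewrite -stieltjes_measure_tail.
  - exact: bigcap_measurable.
  - move=> i j ij; apply/subsetPset/subset_itvr.
    by rewrite bnd_simp lerN2 lef_pV2 ?posrE ?ltr0n// ler_nat.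
have U : \bigcap_(n : nat) `](- n.+1%:R^-1 : R), +oo[%classic = D.
  by rewrite itvcyEbigcap; apply: eq_bigcapr => n _; rewrite sub0r.
rewrite -U; apply/esym; apply: cvg_unique mcvg => //.
rewrite (_ : (fun n => _) = (fun=> (m 0%N)%:E)); first exact: cvg_cst.
apply/funext => n; rewrite stieltjes_measure_tail cumulative_lt0 ?subr0//.
Qed.

Definition bounded_measurable f : Prop :=
  measurable_fun D f /\ exists M : R, forall u : R, 0 <= u -> `|f u| <= M.

Lemma bounded_measurable_integrable f :
  bounded_measurable f -> mu.-integrable D (EFin \o f).
Proof.
move=> [mf [M fM]]; apply: measurable_bounded_integrable => //.
  by rewrite [ltLHS]stieltjes_measure_nonneg ltry.
exists M; split; first exact: num_real.
move=> N MN u; rewrite /= in_itv/= andbT => u0.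
exact: le_trans (fM u u0) (ltW MN).
Qed.

Lemma bounded_measurableZD (c : R) f g :
  bounded_measurable f -> bounded_measurable g ->
  bounded_measurable (fun u => c * f u + g u).
Proof.
move=> [mf [M fM]] [mg [N gN]]; split.
  by apply: measurable_funD => //; exact: measurable_funM.
exists (`|c| * M + N) => u u0; apply: le_trans (ler_normD _ _) _.
by rewrite normrM lerD ?ler_wpM2l ?fM ?gN.
Qed.

Lemma bounded_measurable_cst (c : R) : bounded_measurable (fun=> c).
Proof. by split; [exact: measurable_cst|exists `|c|]. Qed.

Lemma bounded_measurable_indicator x :
  bounded_measurable (fun u => (x < u)%R%:R).
Proof.
split; last by exists 1 => u _; rewrite ger0_norm//; case: (x < u).
rewrite (_ : (fun u => _) = \1_(`]x, +oo[%classic)).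
  exact: measurable_indic.
by apply/funext => u; rewrite indicE mem_setE/= in_itv/= andbT.
Qed.

Lemma bounded_measurable_upto f : bounded_measurable f -> bounded_upto B f.
Proof. by move=> [_ [M fM]]; exists M => u /andP[u0 _]; exact: fM. Qed.

Lemma Rintegral_linear (c : R) f g :
  bounded_measurable f -> bounded_measurable g ->
  \int[mu]_(u in D) (c * f u + g u) =
  c * \int[mu]_(u in D) f u + \int[mu]_(u in D) g u.
Proof.
move=> bf bg; have jf := bounded_measurable_integrable bf.
have jg := bounded_measurable_integrable bg.
rewrite RintegralD// ?RintegralZl//.
apply: (@bounded_measurable_integrable (fun u => c * f u)).
have := bounded_measurableZD c bf (bounded_measurable_cst 0).
by congr bounded_measurable; apply/funext => u; rewrite addr0.
Qed.

Lemma Rintegral_cst_nonneg (c : R) : \int[mu]_(u in D) c = c * m 0%N.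
Proof.
rewrite Rintegral_cst//; congr (_ * _).
exact: (congr1 fine stieltjes_measure_nonneg).
Qed.

Lemma Rintegral_indicator x : 0 <= x ->
  \int[mu]_(u in D) (x < u)%R%:R = m 0%N - Phi x.
Proof.
move=> x0; rewrite /Rintegral.
transitivity (fine (\int[mu]_(u in D) (\1_(`]x, +oo[%classic : set R) u)%:E)%E).
  congr fine; apply: eq_integral => u _.
  by rewrite indicE mem_setE/= in_itv/= andbT.
rewrite integral_indic//.
have -> : (`]x, +oo[ `&` D)%classic = `]x, +oo[%classic.
  by apply/setIidl => u /=; rewrite !in_itv/= !andbT => /ltW; exact: le_trans.
by rewrite [X in fine X]stieltjes_measure_tail.
Qed.

Lemma mfunct_gt_indicator x :
  L (fun u => (x < u)%R%:R) = m 0%N - mass_upto x.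
Proof.
rewrite -(mfunct1 hL) -(mfunctB hL); [|exact: (bounded_upto_cst B 1)|exact: bounded_indicator].
congr L; apply/funext => u.
by rewrite ltNge; case: (u <= x); rewrite ?subrr ?subr0.
Qed.

(** Written with increments of f, so that its integral is a sum of masses of
    half-lines, for both the functional and the measure. *)
Definition step_function (x : nat -> R) f N u : R :=
  f (x 0%N) + \sum_(i < N) (f (x i.+1) - f (x i)) * (x i < u)%R%:R.

Lemma step_functionS (x : nat -> R) f N : step_function x f N.+1 =
  (fun u => (f (x N.+1) - f (x N)) * (x N < u)%R%:R + step_function x f N u).
Proof.
by apply/funext => u; rewrite /step_function big_ord_recr/= addrA addrC.
Qed.

Lemma bounded_measurable_step (x : nat -> R) f N :
  bounded_measurable (step_function x f N).
Proof.
elim: N => [|N IHN]; last first.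
  rewrite step_functionS; apply: bounded_measurableZD => //.
  exact: bounded_measurable_indicator.
rewrite (_ : step_function _ _ _ = fun=> f (x 0%N)).
  exact: bounded_measurable_cst.
by apply/funext => u; rewrite /step_function big_ord0 addr0.
Qed.

(** At each node the two integrals differ by the gap between the right
    continuous cumulative function and [mass_upto]. *)
Lemma step_function_integral_diff (x : nat -> R) f N : (forall i, 0 <= x i) ->
  L (step_function x f N) - \int[mu]_(u in D) step_function x f N u =
  \sum_(i < N) (f (x i.+1) - f (x i)) * (Phi (x i) - mass_upto (x i)).
Proof.
move=> x0; elim: N => [|N IHN].
  rewrite big_ord0; have -> : step_function x f 0 = fun=> f (x 0%N).
    by apply/funext => u; rewrite /step_function big_ord0 addr0.
  by rewrite (mfunct_cst hL) Rintegral_cst_nonneg subrr.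
have bN := bounded_measurable_step x f N.
have b1 := bounded_measurable_indicator (x N).
rewrite big_ord_recr/= -IHN step_functionS (mfunct_linear hL); try exact: bounded_measurable_upto.
rewrite Rintegral_linear// Rintegral_indicator// mfunct_gt_indicator; ring.
Qed.

Lemma step_function_value (x : nat -> R) f N u : {homo x : i j / (i <= j)%N >-> i <= j} ->
  exists2 j, (j <= N)%N & step_function x f N u = f (x j) /\
    ((j == N) || (u <= x j)) /\ ((j == 0)%N || (x j.-1 < u)).
Proof.
move=> xnd; elim: N => [|N [j jN [gE [h1 h2]]]].
  by exists 0%N => //; rewrite /step_function big_ord0 addr0.
rewrite step_functionS; have [xu|ux] := ltP (x N) u; last first.
  rewrite mulr0 add0r; exists j; first exact: leqW.
  split => //; split => //; apply/orP; right.
  by case/orP: h1 => // /eqP ->.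
have jE : j = N.
  apply/eqP; case/orP: h1 => // uj; exfalso.
  by have := lt_le_trans xu (le_trans uj (xnd _ _ jN)); rewrite ltxx.
exists N.+1 => //; rewrite gE jE mulr1 subrK eqxx xu orbT.
by [].
Qed.

(** Step functions on a grid of mesh h over [0, B+1] approximate f there up to
    K h, and there is no mass beyond. For them the two integrals differ by at
    most K h times a telescoping sum: each cumulative value lies between the
    values of [mass_upto] at its node and at the next one. *)
Theorem stieltjes_integral_mfunct f (K : R) : bounded_measurable f ->
  (forall u v : R, 0 <= u -> 0 <= v -> `|f u - f v| <= K * `|u - v|) ->
  \int[mu]_(u in D) f u = L f.
Proof.
move=> bf fK; pose c := B + 1; have c0 : 0 < c by rewrite ltr_wpDl.
have m0 : 0 <= m 0%N by apply: le_trans (mass_below_ge0 0) (mass_below_le 0).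
have K0 : 0 <= K.
  have := fK 1 0 ler01 (lexx 0); rewrite subr0 normr1 mulr1.
  exact: le_trans (normr_ge0 _).
have [M fM] := bf.2.
have M0 : 0 <= M by exact: le_trans (fM 0 (lexx 0)).
pose x (N i : nat) : R := c * i%:R / N.+1%:R.
have N0 N : 0 < N.+1%:R :> R by rewrite ltr0n.
have x0 N i : 0 <= x N i by rewrite /x divr_ge0// mulr_ge0// ltW.
have xS N i : x N i.+1 = x N i + c / N.+1%:R.
  by rewrite /x -natr1 mulrDr mulr1 mulrDl.
have h0 N : 0 < c / N.+1%:R by rewrite divr_gt0.
have xnd N : {homo x N : i j / (i <= j)%N >-> i <= j}.
  by move=> i j ij; rewrite /x !ler_wpM2r ?invr_ge0 ?ler_wpM2l ?ler_nat// ltW.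
have xN N : x N N.+1 = c by rewrite /x mulfK ?gt_eqF.
pose g N := step_function (x N) f N.+1.
have bg N : bounded_measurable (g N) by exact: bounded_measurable_step.
have fg N u : 0 <= u <= c -> `|f u - g N u| <= K * (c / N.+1%:R).
  move=> /andP[u0 uc].
  rewrite /g; have [j jN [-> [h1 h2]]] := step_function_value f N.+1 u (xnd N).
  apply: le_trans (fK _ _ u0 (x0 _ _)) _; apply: ler_wpM2l => //.
  have ujx : u <= x N j by case/orP: h1 => // /eqP ->; rewrite xN.
  have xju : x N j < u + c / N.+1%:R.
    case: j h2 {jN h1 ujx} => [_|j] /=; first by rewrite {1}/x mulr0 mul0r ltr_wpDl.
    by rewrite xS ltrD2r.
  move: (c / N.+1%:R) (x N j) (h0 N) ujx xju => h y h_gt0 uy yu.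
  by rewrite ler_norml; apply/andP; split; lra.
have fgt N u : c < u -> `|f u - g N u| <= 2 * M.
  move=> uc; rewrite /g; have [j _ [-> _]] := step_function_value f N.+1 u (xnd N).
  apply: le_trans (ler_normB _ _) _; rewrite mulrDl mul1r lerD// fM//.
  by rewrite ltW// (lt_trans c0).
have LN N : `|L f - L (g N)| <= K * (c / N.+1%:R) * m 0%N.
  rewrite -(mfunctB hL); try exact: bounded_measurable_upto.
  apply: (mfunct_norm hL) => u /andP[u0 uB]; apply: fg; rewrite u0 /c/=; lra.
have IN N : `|\int[mu]_(u in D) f u - \int[mu]_(u in D) g N u|
    <= K * (c / N.+1%:R) * m 0%N.
  have bd : bounded_measurable (fun u => -1 * g N u + f u) by exact: bounded_measurableZD.
  have bb : bounded_measurable (fun u => 2 * M * (c < u)%R%:R + K * (c / N.+1%:R)).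
    apply: bounded_measurableZD; first exact: bounded_measurable_indicator.
    exact: bounded_measurable_cst.
  rewrite addrC -mulN1r -Rintegral_linear//.
  apply: le_trans (le_normr_Rintegral _ (bounded_measurable_integrable bd)) _ => //.
  apply: (@le_trans _ _ (\int[mu]_(u in D) (2 * M * (c < u)%R%:R + K * (c / N.+1%:R)))).
    apply: le_Rintegral => //.
    - have [mh [M' hM]] := bd; apply: (@bounded_measurable_integrable (fun u => `|-1 * g N u + f u|)).
      by split; [exact: measurableT_comp|exists M' => u u0; rewrite normr_id hM].
    - exact: (bounded_measurable_integrable bb).
    - move=> u; rewrite /= in_itv/= andbT => u0; rewrite mulN1r addrC.
      case: ltP => cu; last by rewrite mulr0 add0r fg// u0.
      by rewrite mulr1 -[leLHS]addr0 lerD ?fgt// mulr_ge0// ltW.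
  rewrite Rintegral_linear ?Rintegral_cst_nonneg ?Rintegral_indicator ?(ltW c0)//.
  - by rewrite cumulative_ge ?subrr ?mulr0 ?add0r// /c; lra.
  - exact: bounded_measurable_indicator.
  - exact: bounded_measurable_cst.
have dN N : `|L (g N) - \int[mu]_(u in D) g N u| <= K * (c / N.+1%:R) * m 0%N.
  rewrite step_function_integral_diff//; apply: le_trans (ler_norm_sum _ _ _) _.
  apply: (@le_trans _ _ (\sum_(i < N.+1) K * (c / N.+1%:R) *
      (mass_upto (x N i.+1) - mass_upto (x N i)))).
    apply: ler_sum => i _; rewrite normrM; apply: ler_pM => //.
      apply: le_trans (fK _ _ (x0 _ _) (x0 _ _)) _.
      by rewrite xS addrAC subrr add0r ger0_norm// ltW.
    have Gle := mass_upto_le_cumulative (x0 N i).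
    have leG : Phi (x N i) <= mass_upto (x N i.+1).
      by apply: cumulative_le_mass_upto => //; rewrite xS ltrDl.
    by rewrite ger0_norm ?subr_ge0// lerD2r.
  rewrite -mulr_sumr; apply: ler_wpM2l; first by apply: mulr_ge0 => //; exact: ltW.
  rewrite -(big_mkord xpredT (fun i => mass_upto (x N i.+1) - mass_upto (x N i))).
  rewrite telescope_sumr// lerBlDr.
  have h1 : mass_upto (x N N.+1) <= m 0%N.
    by rewrite -(mfunct1 hL); exact: (@mfunct_indicator_le (fun u => u <= _) (fun=> true)).
  have h2 : 0 <= mass_upto (x N 0%N).
    by apply: (mfunct_ge0 hL) => *; rewrite ?ler0n//; exact: bounded_indicator.
  lra.
apply/eqP; rewrite -subr_eq0 -normr_le0.
have tri N : `|\int[mu]_(u in D) f u - L f| <= 3 * (K * c * m 0%N * N.+1%:R^-1).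
  have -> : \int[mu]_(u in D) f u - L f =
     (\int[mu]_(u in D) f u - \int[mu]_(u in D) g N u)
     - (L (g N) - \int[mu]_(u in D) g N u) - (L f - L (g N)) by ring.
  apply: le_trans (ler_normB _ _) _; apply: le_trans (lerD (ler_normB _ _) (lexx _)) _.
  have := IN N; have := dN N; have := LN N.
  rewrite (_ : K * (c / N.+1%:R) * m 0%N = K * c * m 0%N * N.+1%:R^-1); last by ring.
  move: (K * c * m 0%N * _) => X; move: `|_| `|_| `|_| => a b d; lra.
have lim0 : (3 * (K * c * m 0%N) * N.+1%:R^-1) @[N --> \oo] --> (0 : R).
  rewrite -[X in _ --> X](mulr0 (3 * (K * c * m 0%N))).
  by apply: cvgMr; exact: cvg_harmonic.
apply: (cvgr_to_ge lim0); apply: nearW => N.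
by rewrite -(mulrA 3); exact: tri.
Qed.

End DistributionFunction.

(** * The integral representation *)

Section StieltjesKernel.
Variable R : realType.
Implicit Types (z : R[i]) (f : R -> R).

Lemma lipschitz_bounded_measurable f (K M : R) :
  (forall u v : R, 0 <= u -> 0 <= v -> `|f u - f v| <= K * `|u - v|) ->
  (forall u : R, 0 <= u -> `|f u| <= M) -> bounded_measurable f.
Proof.
move=> fK fM; split; last by exists M.
apply: subspace_continuous_measurable_fun => //.
apply/subspace_continuousP => v /=; rewrite in_itv/= andbT => v0.
have K0 : 0 < `|K| + 1 by rewrite ltr_wpDl.
apply/cvgrPdist_lt => e e0; apply/nbhs_ballP.
exists (e / (`|K| + 1)) => [|u]; first by rewrite /= divr_gt0.
rewrite /ball/= ltr_pdivlMr// mulrC => uv; rewrite in_itv/= andbT => u0.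
apply: le_lt_trans (fK _ _ v0 u0) _; apply: le_lt_trans uv.
by rewrite ler_wpM2r//; apply: le_trans (ler_norm K) _; rewrite lerDl.
Qed.

(** The kernel is bounded because 1 + u z stays away from 0, and its increments
    factor as z (v - u)/((1 + u z)(1 + v z)). *)
Lemma slit_plane_kernel_lipschitz z : slit_plane 0 z ->
  exists K M : R, (forall u v : R, 0 <= u -> 0 <= v ->
      normc (1 / (1 + u%:C * z) - 1 / (1 + v%:C * z)) <= K * `|u - v|) /\
    forall u : R, 0 <= u -> normc (1 / (1 + u%:C * z)) <= M.
Proof.
move=> /slit_plane_normc_ge[c c0 cP].
have n0 (u : R) : 0 <= u -> 1 + u%:C * z != 0.
  move=> /cP cu; apply/eqP => u0; move: cu; rewrite u0 normc0.
  by rewrite leNgt c0.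
have inv_le (u : R) : 0 <= u -> normc (1 / (1 + u%:C * z)) <= c^-1.
  move=> u0; rewrite div1r normcV lef_pV2 ?posrE//; first exact: cP.
  exact: lt_le_trans c0 (cP u u0).
exists (c^-1 * c^-1 * normc z), c^-1; split => // u v u0 v0.
have -> : 1 / (1 + u%:C * z) - 1 / (1 + v%:C * z) =
    (1 / (1 + u%:C * z)) * (1 / (1 + v%:C * z)) * z * (v - u)%:C.
  rewrite rmorphB/=; have := n0 u u0; have := n0 v v0.
  by move: (u%:C) (v%:C) => a b h1 h2; field; apply/andP; split.
rewrite normcM normc_real (distrC v) ler_wpM2r// normcM ler_wpM2r ?normc_ge0//.
by rewrite normcM ler_pM ?normc_ge0 ?inv_le.
Qed.

End StieltjesKernel.

Theorem theorem2p1 (R : realType) (W : R[i] -> R[i])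
    (hW : principal_lambertW W) :
  exists (Phi : R -> R) (ndPhi : nondecreasing_nonneg Phi),
    [bounded Phi u | u in `[0, +oo[%classic] /\
    forall z : R[i], slit_plane 0 z ->
      W z / z = stieltjes_integral ndPhi (fun u => 1 / (1 + u%:C * z)).
Proof.
have [L hL] := hausdorff_moment_functional (expR_gt0 (1 : R))
  (@monotone_upto_lambert_moment R).
have B0 : 0 <= expR 1 :> R by exact: expR_ge0.
exists (mass_below L), (nondecreasing_mass_below hL).
split; first exact: mass_below_bounded hL.
move=> z zP; have zn0 : z != 0.
  by apply/eqP => z0; apply: zP; rewrite z0 /= lexx.
rewrite (principal_lambertW_ray hL B0 hW zP) /ray_transform !mul1r mulrAC divff// mul1r.
have [K [M [fK fM]]] := slit_plane_kernel_lipschitz zP.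
pose f u : R[i] := 1 / (1 + u%:C * z).
have mfunctE (g : R -> R) :
    (forall u v : R, 0 <= u -> 0 <= v -> `|g u - g v| <= normc (f u - f v)) ->
    (forall u : R, 0 <= u -> `|g u| <= normc (f u)) ->
    (\int[stieltjes_measure (nondecreasing_mass_below hL)]_(u in `[(0 : R), +oo[) g u) = L g.
  move=> gf gn; have gK (u v : R) : 0 <= u -> 0 <= v -> `|g u - g v| <= K * `|u - v|.
    by move=> u0 v0; exact: le_trans (gf u v u0 v0) (fK u v u0 v0).
  apply: (stieltjes_integral_mfunct hL B0 _ _ gK).
  apply: (lipschitz_bounded_measurable gK) => u u0.
  exact: le_trans (gn u u0) (fM u u0).
rewrite /cfunct /stieltjes_integral !mfunctE.
- by congr (_ +i* _); congr L; apply/funext => u; rewrite div1r.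
- by move=> u v _ _; rewrite -raddfB; exact: le_Im_normc.
- by move=> u _; exact: le_Im_normc.
- by move=> u v _ _; rewrite -raddfB; exact: le_Re_normc.
- by move=> u _; exact: le_Re_normc.
Qed.
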